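(* Let $T_A$ be the rearrangement group of the Airplane limit space and $\alpha,\beta,\gamma,\delta,\varepsilon\in T_A$ the elements described in the context. Then $$[T_A,T_A]=\langle \alpha,\ \beta,\ \gamma,\ \delta,\ [\delta,\varepsilon],\ [\varepsilon^{-1},\varepsilon^{-1}\circ\alpha]\rangle .$$
   Context: The Airplane rearrangement group $T_A$. Graphs are finite directed multigraphs with edges coloured red or blue. The base graph $\Gamma$ has vertices $l,a,b,r$, blue edges $e_L:a\to l$ and $e_R:b\to r$, and red edges $e_U:b\to a$ and $e_D:a\to b$. Replacement rules: a red edge from $v_i$ to $v_t$ is replaced by the graph with vertices $v_i,v_t$ and two new vertices $m,w$, with red edges $\mathsf r_1:v_i\to m$, $\mathsf r_2:m\to v_t$ and a blue edge $\mathsf s:m\to w$; a blue edge from $v_i$ to $v_t$ is replaced by the graph with vertices $v_i,v_t$ and two new vertices $x,y$, with blue edges $\mathsf b_-:x\to v_i$, $\mathsf b_+:y\to v_t$ and red edges $\mathsf u:y\to x$, $\mathsf d:x\to y$. An expansion is any graph obtained from $\Gamma$ by finitely many (possibly zero) replacements of single edges. Each edge of an expansion is named by the finite word $e_0e_1\cdots e_k$ recording the edge $e_0$ of $\Gamma$ from which it descends and the successive edges of replacement graphs. Let $\Gamma_0=\Gamma$, and let $\Gamma_{n+1}$ be obtained from $\Gamma_n$ by replacing every edge. Let $\Omega$ be the set of infinite words all of whose finite nonempty prefixes name edges (topologized as a subspace of a product of finite discrete sets). Two such words $e_0e_1\cdots$ and $f_0f_1\cdots$ are equivalent if for every $n$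 the edges $e_0\cdots e_n$ and $f_0\cdots f_n$ of $\Gamma_n$ share at least one vertex; this is an equivalence relation, and the Airplane limit space $A$ is the quotient of $\Omega$ by it, with the quotient topology. The cell $\chi(e)$ of an edge $e$ is the set of points of $A$ represented by words beginning with $e$. A cellular partition is a cover of $A$ by finitely many cells with pairwise disjoint interiors. If $e,e'$ are edges of the same colour, the canonical homeomorphism $\chi(e)\to\chi(e')$ sends the class of $ew$ to the class of $e'w$. A rearrangement is a homeomorphism $f:A\to A$ for which there is a cellular partition such that $f$ restricts on each of its cells to a canonical homeomorphism onto some cell. Rearrangements form a group $T_A$ under composition ($f\circ g$ means first $g$, then $f$). Commutators are $[g,f]=g\circ f\circ g^{-1}\circ f^{-1}$. The elements $\alpha,\beta,\gamma,\delta,\varepsilon$. Below, $e\mapsto e'$ means that the element maps $\chi(e)$ onto $\chi(e')$ canonically, and $e\mapsto e'$ (rev), for blue edges, means that it maps $\chi(e)$ onto $\chi(e')$ by the orientation-reversed map sending the classes of $e\mathsf b_\pm w$, $e\mathsf u w$, $e\mathsf d w$ to those of $e'\mathsf b_\mp w$, $e'\mathsf d w$, $e'\mathsf u w$. - $\alpha$: $e_L\mathsf b_+\mapsto e_L$, $e_L\mathsf d\mapsto e_U$, $e_L\mathsf u\mapsto e_D$, $e_L\mathsf b_-\mapsto e_R\mathsf b_-$ (rev), $e_U\mapsto e_R\mathsf u$, $e_D\mapsto e_R\mathsf d$, $e_R\mapsto e_R\mathsf b_+$. - $\beta$: $e_L\mapsto e_U\mathsf s$, $e_U\mapsto e_U\mathsf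 r_1$, $e_D\mathsf r_1\mapsto e_U\mathsf r_2$, $e_D\mathsf r_2\mapsto e_D$, $e_D\mathsf s\mapsto e_L$, $e_R\mapsto e_R$. - $\gamma$: $e_L\mapsto e_L$, $e_D\mapsto e_D$, $e_R\mapsto e_R$, $e_U\mathsf r_1\mapsto e_U\mathsf r_1\mathsf r_1$, $e_U\mathsf s\mapsto e_U\mathsf r_1\mathsf s$, $e_U\mathsf r_2\mathsf r_1\mapsto e_U\mathsf r_1\mathsf r_2$, $e_U\mathsf r_2\mathsf s\mapsto e_U\mathsf s$, $e_U\mathsf r_2\mathsf r_2\mapsto e_U\mathsf r_2$. - $\delta$: $e_L\mapsto e_R$, $e_R\mapsto e_L$, $e_U\mapsto e_D$, $e_D\mapsto e_U$. - $\varepsilon$: $e_L\mapsto e_L$, $e_U\mapsto e_U$, $e_D\mapsto e_D$, $e_R\mathsf b_-\mathsf b_+\mapsto e_R\mathsf b_-$, $e_R\mathsf b_-\mathsf d\mapsto e_R\mathsf u$, $e_R\mathsf b_-\mathsf u\mapsto e_R\mathsf d$, $e_R\mathsf b_-\mathsf b_-\mapsto e_R\mathsf b_+\mathsf b_-$ (rev), $e_R\mathsf u\mapsto e_R\mathsf b_+\mathsf u$, $e_R\mathsf d\mapsto e_R\mathsf b_+\mathsf d$, $e_R\mathsf b_+\mapsto e_R\mathsf b_+\mathsf b_+$. *)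

(* Defs.v *)
From HB Require Import structures.
From mathcomp Require Import all_boot.
From mathcomp Require Import all_classical.
From mathcomp Require Import topology.

Set Implicit Arguments.
Unset Strict Implicit.
Unset Printing Implicit Defensive.

Local Open Scope classical_set_scope.
Local Open Scope quotient_scope.

Record homeo (X : topologicalType) := Homeo {
  homeo_fun :> X -> X;
  homeo_inv : X -> X;
  homeo_funK : cancel homeo_fun homeo_inv;
  homeo_invK : cancel homeo_inv homeo_fun;
  homeo_fun_continuous : continuous homeo_fun;
  homeo_inv_continuous : continuous homeo_inv }.

Section HomeoGroup.
Variable X : topologicalType.
Implicit Types f g h : homeo X.

Lemma homeo_eqP f g : (f : X -> X) =1 g -> f = g.
Proof.
case: f g => [f f' fK f'K cf cf'] [g g' gK g'K cg cg'] /= /funext efg.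
have efg' : f' = g' by apply/funext=> x; rewrite -[in LHS](g'K x) -efg fK.
by subst g g'; congr Homeo; exact: Prop_irrelevance.
Qed.

HB.instance Definition _ := gen_eqMixin (homeo X).
HB.instance Definition _ := gen_choiceMixin (homeo X).

Definition homeo_id : homeo X :=
  @Homeo X id id (fun=> erefl) (fun=> erefl)
    (fun x => cvg_id) (fun x => cvg_id).

Definition homeo_inverse f : homeo X :=
  Homeo (@homeo_invK X f) (@homeo_funK X f)
    (@homeo_inv_continuous X f) (@homeo_fun_continuous X f).

(* First g, then f.                                                           *)
Program Definition homeo_comp f g : homeo X :=
  @Homeo X (f \o g) (homeo_inv g \o homeo_inv f) _ _ _ _.
Next Obligation. by move=> f g x /=; rewrite !homeo_funK. Qed.
Next Obligation. by move=> f g x /=; rewrite !homeo_invK. Qed.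
Next Obligation.
by move=> f g x; apply: continuous_comp; exact: homeo_fun_continuous.
Qed.
Next Obligation.
by move=> f g x; apply: continuous_comp; exact: homeo_inv_continuous.
Qed.

Lemma homeo_compA : associative homeo_comp.
Proof. by move=> f g h; exact: homeo_eqP. Qed.
Lemma homeo_comp1f : left_id homeo_id homeo_comp.
Proof. by move=> f; exact: homeo_eqP. Qed.
Lemma homeo_compf1 : right_id homeo_id homeo_comp.
Proof. by move=> f; exact: homeo_eqP. Qed.
Lemma homeo_compVf : left_inverse homeo_id homeo_inverse homeo_comp.
Proof. by move=> f; apply: homeo_eqP => x /=; rewrite homeo_funK. Qed.
Lemma homeo_compfV : right_inverse homeo_id homeo_inverse homeo_comp.
Proof. by move=> f; apply: homeo_eqP => x /=; rewrite homeo_invK. Qed.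

HB.instance Definition _ := isGroup.Build (homeo X)
  homeo_compA homeo_comp1f homeo_compf1 homeo_compVf homeo_compfV.

End HomeoGroup.

Section Subgroups.
Local Open Scope group_scope.
Variable G : groupType.
Implicit Types S T : set G.

Definition subgroup S :=
  [/\ S 1, forall x y, S x -> S y -> S (x * y) & forall x, S x -> S x^-1].

Definition generated S : set G := smallest subgroup S.

(* MathComp's [~ g, f] is g^-1 * f^-1 * g * f, hence this definition.         *)
Definition commutator (g f : G) : G := g * f * g^-1 * f^-1.

Definition derived T : set G :=
  generated [set commutator g f | g in T & f in T].

End Subgroups.

(* [eL] .. [eD] are the edges of the base graph, [r1], [r2], [s_] those of    *)
(* the red replacement graph, [bm], [bp], [u_], [d_] those of the blue one    *)
(* (with bm, bp for b_-, b_+).                                                *)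
Inductive symbol := eL | eR | eU | eD | r1 | r2 | s_ | bm | bp | u_ | d_.

Definition symbols := [:: eL; eR; eU; eD; r1; r2; s_; bm; bp; u_; d_].

Definition symbol_code (c : symbol) : nat :=
  match c with
  | eL => 0 | eR => 1 | eU => 2 | eD => 3 | r1 => 4 | r2 => 5 | s_ => 6
  | bm => 7 | bp => 8 | u_ => 9 | d_ => 10
  end.

Lemma symbol_codeK : cancel symbol_code (nth eL symbols).
Proof. by case. Qed.

HB.instance Definition _ := Countable.copy symbol (can_type symbol_codeK).

Lemma symbols_enumP : Finite.axiom symbols.
Proof. by case. Qed.

HB.instance Definition _ := isFinite.Build symbol symbols_enumP.

Definition word := seq symbol.

Inductive colour := Red | Blue.

Definition is_red (c : colour) := if c is Red then true else false.
Definition red_if (b : bool) := if b then Red else Blue.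
Lemma is_redK : cancel is_red red_if. Proof. by case. Qed.
HB.instance Definition _ := Countable.copy colour (can_type is_redK).

Inductive vertex_name := v_l | v_a | v_b | v_r | v_m | v_w | v_x | v_y.

Definition vertex_names := [:: v_l; v_a; v_b; v_r; v_m; v_w; v_x; v_y].
Definition vertex_name_code (v : vertex_name) : nat :=
  match v with
  | v_l => 0 | v_a => 1 | v_b => 2 | v_r => 3
  | v_m => 4 | v_w => 5 | v_x => 6 | v_y => 7
  end.
Lemma vertex_name_codeK : cancel vertex_name_code (nth v_l vertex_names).
Proof. by case. Qed.
HB.instance Definition _ :=
  Countable.copy vertex_name (can_type vertex_name_codeK).

(* The first component is the name of the edge whose replacement created the  *)
(* vertex; it is empty for the vertices of the base graph.                    *)
Definition vertex : Type := word * vertex_name.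

Record edge := Edge {
  name : word; col : colour; src : vertex; tgt : vertex }.

Definition edge_tuple (e : edge) := (name e, col e, src e, tgt e).
Definition tuple_edge (x : word * colour * vertex * vertex) :=
  let: (n, c, i, t) := x in Edge n c i t.
Lemma edge_tupleK : cancel edge_tuple tuple_edge. Proof. by case. Qed.
HB.instance Definition _ := Countable.copy edge (can_type edge_tupleK).

(* A graph is given by its edges, as no isolated vertex ever occurs.          *)
Definition graph := seq edge.

Definition base_graph : graph :=
  let v k : vertex := ([::], k) in
  [:: Edge [:: eL] Blue (v v_a) (v v_l); Edge [:: eR] Blue (v v_b) (v v_r);
      Edge [:: eU] Red (v v_b) (v v_a); Edge [:: eD] Red (v v_a) (v v_b)].

Definition replacement (e : edge) : graph :=
  let: Edge n c vi vt := e in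
  let v k : vertex := (n, k) in
  match c with
  | Red => [:: Edge (rcons n r1) Red vi (v v_m);
               Edge (rcons n r2) Red (v v_m) vt;
               Edge (rcons n s_) Blue (v v_m) (v v_w)]
  | Blue => [:: Edge (rcons n bm) Blue (v v_x) vi;
                Edge (rcons n bp) Blue (v v_y) vt;
                Edge (rcons n u_) Red (v v_y) (v v_x);
                Edge (rcons n d_) Red (v v_x) (v v_y)]
  end.

Inductive expansion : graph -> Prop :=
| expansion_base : expansion base_graph
| expansion_replace G1 e G2 :
    expansion (G1 ++ e :: G2) -> expansion (G1 ++ replacement e ++ G2).

Definition full_expansion (n : nat) : graph :=
  iter n (fun G => flatten [seq replacement e | e <- G]) base_graph.

Definition names_edge_col (w : word) (c : colour) :=
  exists G e, [/\ expansion G, e \in G, name e = w & col e = c].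

Definition names_edge (w : word) := exists c, names_edge_col w c.

Definition symbol_sequences :=
  prod_topology (fun _ : nat => discrete_topology symbol).

Definition prefix_of (w : nat -> symbol) (n : nat) : word := mkseq w n.

Definition Omega_set : set symbol_sequences :=
  [set w | forall n, names_edge (prefix_of w n.+1)].

Definition Omega : topologicalType := set_type Omega_set.

Definition ends (e : edge) : seq vertex := [:: src e; tgt e].

Definition share_vertex (e f : edge) := exists2 v, v \in ends e & v \in ends f.

Definition glued (w v : Omega) :=
  forall n, exists e f,
    [/\ e \in full_expansion n, f \in full_expansion n,
        name e = prefix_of (val w) n.+1, name f = prefix_of (val v) n.+1 &
        share_vertex e f].

Lemma full_expansionS n e :
  e \in full_expansion n.+1 ->
  exists2 e0, e0 \in full_expansion n & e \in replacement e0.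
Proof. by move=> /flatten_mapP. Qed.

Lemma name_replacement e f :
  f \in replacement e -> exists c, name f = rcons (name e) c.
Proof.
case: e => n [] i t; rewrite !inE.
- by case/or3P=> /eqP->; [exists r1|exists r2|exists s_].
- by case/or4P=> /eqP->; [exists bm|exists bp|exists u_|exists d_].
Qed.

Lemma replacement_inj e f f' :
  f \in replacement e -> f' \in replacement e -> name f = name f' -> f = f'.
Proof.
by case: e => n [] i t; rewrite !inE; [case/or3P|case/or4P] => /eqP->;
  [case/or3P|case/or3P|case/or3P|case/or4P|case/or4P|case/or4P|case/or4P]
    => /eqP-> //= /rcons_inj[].
Qed.

Lemma size_name n e : e \in full_expansion n -> size (name e) = n.+1.
Proof.
elim: n e => [|n IHn] e; first by rewrite !inE; case/or4P=> /eqP->.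
case/full_expansionS=> e0 /IHn + /name_replacement[c ->].
by rewrite size_rcons => ->.
Qed.

Lemma name_inj n : {in full_expansion n &, injective name}.
Proof.
elim: n => [|n IHn] e f.
  by rewrite !inE => /or4P[] /eqP-> /or4P[] /eqP->.
case/full_expansionS=> e0 e0n ee0 /full_expansionS[f0 f0n ff0] nef.
have [[c ec] [c' fc]] := (name_replacement ee0, name_replacement ff0).
move: (nef); rewrite ec fc => /rcons_inj[/IHn-/(_ e0n f0n) e0f0 _].
by apply: (@replacement_inj e0) => //; rewrite e0f0.
Qed.

Lemma expansion_full G e :
  expansion G -> e \in G -> exists n, e \in full_expansion n.
Proof.
move=> GP; elim: GP e => [|G1 f G2 _ IH] e; first by exists 0.
rewrite !mem_cat => /or3P[eG|ef|eG].
- by apply: IH; rewrite mem_cat eG.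
- have [|n fn] := IH f; first by rewrite mem_cat inE eqxx orbT.
  by exists n.+1; apply/flatten_mapP; exists f.
- by apply: IH; rewrite mem_cat inE eG !orbT.
Qed.

Lemma ends_replacement e f v :
  f \in replacement e -> v \in ends f -> (v \in ends e) || (v.1 == name e).
Proof.
by case: e => n [] i t; rewrite !inE; [case/or3P|case/or4P] => /eqP->;
  move=> /orP[] /eqP-> /=; rewrite ?eqxx ?orbT.
Qed.

Lemma old_end_unique e f v v' : f \in replacement e ->
  v \in ends f -> v' \in ends f -> v.1 != name e -> v'.1 != name e -> v = v'.
Proof.
by case: e => n [] i t; rewrite !inE; [case/or3P|case/or4P] => /eqP->;
  move=> /orP[] /eqP-> /orP[] /eqP-> //=; rewrite ?eqxx.
Qed.

Lemma size_ends n e v :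
  e \in full_expansion n -> v \in ends e -> size v.1 < n.+1.
Proof.
elim: n e => [|n IHn] e.
  by rewrite !inE => /or4P[] /eqP-> /=; rewrite ?inE => /orP[] /eqP->.
case/full_expansionS=> e0 e0n ee0 /(ends_replacement ee0)/orP[/(IHn _ e0n)|].
  exact: ltnW.
by move=> /eqP->; rewrite (size_name e0n).
Qed.

Lemma glued_refl w : glued w w.
Proof.
move=> n; have /set_mem/= /(_ n) [c [G [e [GP eG en _]]]] := valP w.
have [m em] := expansion_full GP eG.
have mn : m = n.
  by apply: succn_inj; rewrite -(size_name em) en size_mkseq.
subst m; exists e, e; split; [exact: em | exact: em | exact: en | exact: en |].
by exists (src e); rewrite inE eqxx.
Qed.

Lemma glued_sym w v : glued w v -> glued v w.
Proof.
move=> wv n; have [e [f [en fn we vf [p pe pf]]]] := wv n.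
by exists f, e; split=> //; exists p.
Qed.

Lemma name_parent (w : nat -> symbol) n e e0 :
  e \in replacement e0 -> name e = prefix_of w n.+2 ->
  name e0 = prefix_of w n.+1.
Proof.
move=> /name_replacement[c ->].
by rewrite /prefix_of /mkseq -[in RHS]addn1 iotaD map_cat cats1
  => /rcons_inj[].
Qed.

Lemma shared_end_old n e f e0 f0 v :
  e0 \in full_expansion n -> f0 \in full_expansion n -> e0 != f0 ->
  e \in replacement e0 -> f \in replacement f0 ->
  v \in ends e -> v \in ends f ->
  [/\ v \in ends e0, v \in ends f0, v.1 != name e0 & v.1 != name f0].
Proof.
move=> e0n f0n e0f0 ee0 ff0 ve vf.
have nef : name e0 != name f0.
  by apply: contra_neq e0f0 => /name_inj-/(_ n e0n f0n).
have old g0 g1 : g0 \in full_expansion n -> g1 \in full_expansion n ->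
    v \in ends g0 -> v.1 != name g1.
  move=> g0n g1n vg; apply: contraTneq (size_ends g0n vg) => ->.
  by rewrite (size_name g1n) ltnn.
have /orP[ve0|/eqP ve0] := ends_replacement ee0 ve.
- have vf1 := old _ _ e0n f0n ve0.
  have := ends_replacement ff0 vf; rewrite (negPf vf1) orbF => vf0.
  by split=> //; exact: old ve0.
- have /orP[vf0|] := ends_replacement ff0 vf; last by rewrite ve0 (negPf nef).
  by have := old _ _ f0n e0n vf0; rewrite ve0 eqxx.
Qed.

Lemma glued_trans w v u : glued w v -> glued v u -> glued w u.
Proof.
move=> wv vu n.
have [e [f [en fn we vf [p pe pf]]]] := wv n.+1.
have [f' [g [f'n gn vf' ug [q qf qg]]]] := vu n.+1.
have ff' : f = f' by apply: (@name_inj n.+1) => //; rewrite vf.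
subst f'.
have [e0 e0n ee0] := full_expansionS en.
have [f0 f0n ff0] := full_expansionS fn.
have [g0 g0n gg0] := full_expansionS gn.
have we0 := name_parent ee0 we.
have vf0 := name_parent ff0 vf.
have ug0 := name_parent gg0 ug.
exists e0, g0; split=> //.
have [e0f0|e0f0] := eqVneq e0 f0.
  have [f1 [g1 [f1n g1n vf1 ug1 fg]]] := vu n; rewrite e0f0.
  rewrite (name_inj f0n f1n (etrans vf0 (esym vf1))).
  by rewrite (name_inj g0n g1n (etrans ug0 (esym ug1))).
have [g0f0|f0g0] := eqVneq f0 g0.
  have [e1 [f1 [e1n f1n we1 vf1 ef]]] := wv n; rewrite -g0f0.
  rewrite (name_inj e0n e1n (etrans we0 (esym we1))).
  by rewrite (name_inj f0n f1n (etrans vf0 (esym vf1))).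
have [pe0 _ _ pf0] := shared_end_old e0n f0n e0f0 ee0 ff0 pe pf.
have [_ qg0 qf0 _] := shared_end_old f0n g0n f0g0 ff0 gg0 qf qg.
exists p => //.
by rewrite (old_end_unique ff0 pf qf).
Qed.

Definition gluedb : rel Omega := fun w v => `[< glued w v >].

Lemma gluedb_equiv : equiv_class_of gluedb.
Proof.
split.
- by move=> w; apply/asboolP; exact: glued_refl.
- by move=> w v; apply/asboolP/asboolP; exact: glued_sym.
- by move=> v w u /asboolP wv /asboolP vu; apply/asboolP; exact: glued_trans vu.
Qed.

Canonical gluedb_equiv_rel := EquivRelPack gluedb_equiv.

Definition airplane : topologicalType :=
  quotient_topology {eq_quot gluedb_equiv_rel}.

Definition point_of (w : Omega) : airplane :=
  \pi_{eq_quot gluedb_equiv_rel} w.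

Definition prepend (e : word) (t : nat -> symbol) : nat -> symbol :=
  fun n => nth (t (n - size e)) e n.

Definition cell (e : word) : set airplane :=
  [set point_of w | w in [set w | exists t, val w = prepend e t]].

(* A word names edges of one colour only, so this says that e and e' are      *)
(* edges of the same colour and f restricts on the cell of e to the canonical *)
(* homeomorphism onto the cell of e'.                                         *)
Definition canonical_on (f : airplane -> airplane) (e e' : word) :=
  (exists c, names_edge_col e c /\ names_edge_col e' c) /\
  forall t (w w' : Omega), val w = prepend e t -> val w' = prepend e' t ->
    f (point_of w) = point_of w'.

(* The orientation-reversed map between cells of blue edges, described by its *)
(* effect on the four subcells.                                               *)
Definition reversed_on (f : airplane -> airplane) (e e' : word) :=
  [/\ names_edge_col e Blue, names_edge_col e' Blue &
      forall c c', (c, c') \in [:: (bm, bp); (bp, bm); (u_, d_); (d_, u_)] ->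
      forall t (w w' : Omega),
        val w = prepend (rcons e c) t -> val w' = prepend (rcons e' c') t ->
        f (point_of w) = point_of w'].

Definition cellular_partition (P : seq word) :=
  [/\ forall e, e \in P -> names_edge e,
      forall p, exists2 e, e \in P & cell e p &
      forall e e', e \in P -> e' \in P -> e != e' ->
        (cell e)° `&` (cell e')° = set0].

(* T_A is kept as a subset of the group of all self-homeomorphisms, in which  *)
(* commutators and generated subgroups are taken.                             *)
Definition T_A : set (homeo airplane) :=
  [set f | exists2 P, cellular_partition P &
     forall e, e \in P -> exists e', canonical_on f e e'].

Definition is_alpha (f : airplane -> airplane) :=
  [/\ canonical_on f [:: eL; bp] [:: eL],
      canonical_on f [:: eL; d_] [:: eU],
      canonical_on f [:: eL; u_] [:: eD] &
      reversed_on f [:: eL; bm] [:: eR; bm]] /\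
  [/\ canonical_on f [:: eU] [:: eR; u_],
      canonical_on f [:: eD] [:: eR; d_] &
      canonical_on f [:: eR] [:: eR; bp]].

Definition is_beta (f : airplane -> airplane) :=
  [/\ canonical_on f [:: eL] [:: eU; s_],
      canonical_on f [:: eU] [:: eU; r1] &
      canonical_on f [:: eD; r1] [:: eU; r2]] /\
  [/\ canonical_on f [:: eD; r2] [:: eD],
      canonical_on f [:: eD; s_] [:: eL] &
      canonical_on f [:: eR] [:: eR]].

Definition is_gamma (f : airplane -> airplane) :=
  [/\ canonical_on f [:: eL] [:: eL],
      canonical_on f [:: eD] [:: eD] &
      canonical_on f [:: eR] [:: eR]] /\
  [/\ canonical_on f [:: eU; r1] [:: eU; r1; r1],
      canonical_on f [:: eU; s_] [:: eU; r1; s_],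
      canonical_on f [:: eU; r2; r1] [:: eU; r1; r2],
      canonical_on f [:: eU; r2; s_] [:: eU; s_] &
      canonical_on f [:: eU; r2; r2] [:: eU; r2]].

Definition is_delta (f : airplane -> airplane) :=
  [/\ canonical_on f [:: eL] [:: eR],
      canonical_on f [:: eR] [:: eL],
      canonical_on f [:: eU] [:: eD] &
      canonical_on f [:: eD] [:: eU]].

Definition is_epsilon (f : airplane -> airplane) :=
  [/\ canonical_on f [:: eL] [:: eL],
      canonical_on f [:: eU] [:: eU] &
      canonical_on f [:: eD] [:: eD]] /\
  [/\ canonical_on f [:: eR; bm; bp] [:: eR; bm],
      canonical_on f [:: eR; bm; d_] [:: eR; u_],
      canonical_on f [:: eR; bm; u_] [:: eR; d_] &
      reversed_on f [:: eR; bm; bm] [:: eR; bp; bm]] /\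
  [/\ canonical_on f [:: eR; u_] [:: eR; bp; u_],
      canonical_on f [:: eR; d_] [:: eR; bp; d_] &
      canonical_on f [:: eR; bp] [:: eR; bp; bp]].

(* Main.v *)
Require Import Defs.
From mathcomp Require Import all_boot all_classical topology zify.

(** Write [H] for the subgroup on the right-hand side.  Both inclusions rest on
    two facts.  The first is that [alpha, .., epsilon] generate [T_A].  The
    second is a list of eight short relations between these five elements, each
    verified by letting both sides act on the edges of one full expansion.

    Generation.  An element [f] of [T_A] is described by a pair of expansions
    whose edges it matches, called a table of [f] below ([T_A_table]).  A blue
    edge may be matched with reversal of its orientation; this makes the class
    of tables stable under the five generators, each of which acts on
    expansions by a local change of their trees.  The proof is by induction on
    the number of blue edges expanded in the domain, that is, on the number of
    noncentral circles.  Moving the root of the domain with [alpha], and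
    rearranging the central circle with [beta] and [gamma], one gathers all the
    noncentral circles behind the right ray [eR] and makes the upper arc a
    single edge, the lower arc a comb ([blue_to_R]).  In the range, the vertex
    [f b] is brought to [b] by a word induction on a red edge at that vertex
    ([reach_red]), and the central circle is combed likewise.  Now [f] fixes [b]
    and respects incidence, so following the two combs edge after edge it is the
    identity on the central circle and on all rays but [eR] ([comb_case]).
    Powers of [epsilon] make the circle of [eR] adjacent to the central one on
    both sides; then conjugation by [alpha] makes it central, and in the new
    tables the whole cell of [eL] is fixed, so its expansion can be undone: one
    circle has been removed ([base_case]).

    Incidence is needed almost only at the four vertices of the base graph,
    because everything is first moved there ([at_baseP]).  Points with a unique name,
    those of a word ending in r1 r2 r1 r2 .., separate cells: they give the
    passage between topological statements (partitions with disjoint interiors)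
    and combinatorial ones.

    The inclusion in [H].  By the relations, [epsilon] commutes with [beta] and
    [gamma], and on everything that commutes with [delta epsilon delta^-1] it
    acts by conjugation like the inverse of the element [[delta, epsilon]] of
    [H].  Since [delta] is a product of [beta] and of a conjugate of [beta] by
    [delta], this shows that [epsilon] normalizes [H] ([gens_commutators]).
    Hence [T_A] modulo [H] is cyclic, and the derived subgroup lies in [H].

    The inclusion of [H].  The relations, read modulo the derived subgroup, kill
    [alpha], [gamma], [beta] and [delta] one after the other; the other two
    generators of [H] are commutators. *)

Set Implicit Arguments.
Unset Strict Implicit.
Unset Printing Implicit Defensive.

Local Open Scope classical_set_scope.
Local Open Scope quotient_scope.

(** * Edges, colours and infinite words *)

Definition stream := nat -> symbol.

Definition base_edge (c : symbol) : option edge :=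
  let v k : vertex := ([::], k) in
  match c with
  | eL => Some (Edge [:: eL] Blue (v v_a) (v v_l))
  | eR => Some (Edge [:: eR] Blue (v v_b) (v v_r))
  | eU => Some (Edge [:: eU] Red (v v_b) (v v_a))
  | eD => Some (Edge [:: eD] Red (v v_a) (v v_b))
  | _ => None
  end.

Definition child (E : edge) (c : symbol) : option edge :=
  let: Edge n k i t := E in
  let v x : vertex := (n, x) in
  match k, c with
  | Red, r1 => Some (Edge (rcons n r1) Red i (v v_m))
  | Red, r2 => Some (Edge (rcons n r2) Red (v v_m) t)
  | Red, s_ => Some (Edge (rcons n s_) Blue (v v_m) (v v_w))
  | Blue, bm => Some (Edge (rcons n bm) Blue (v v_x) i)
  | Blue, bp => Some (Edge (rcons n bp) Blue (v v_y) t)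
  | Blue, u_ => Some (Edge (rcons n u_) Red (v v_y) (v v_x))
  | Blue, d_ => Some (Edge (rcons n d_) Red (v v_x) (v v_y))
  | _, _ => None
  end.

Definition edge_of (e : word) : option edge :=
  if e is c :: v then foldl (fun o c => obind (child^~ c) o) (base_edge c) v
  else None.

Definition next_colour (k : colour) (c : symbol) : option colour :=
  match k, c with
  | Red, r1 | Red, r2 | Blue, u_ | Blue, d_ => Some Red
  | Red, s_ | Blue, bm | Blue, bp => Some Blue
  | _, _ => None
  end.

Definition run (k : colour) (v : word) : option colour :=
  foldl (fun o c => obind (next_colour^~ c) o) (Some k) v.

Definition colour_of (e : word) : option colour := omap col (edge_of e).

Definition valid_tail (k : colour) (t : stream) := forall n, run k (mkseq t n).

(** The sequences that represent points of the limit space; the tails of those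
    that begin with a given edge depend on its colour only ([valid_prepend]). *)
Definition valid (w : stream) := forall n, edge_of (mkseq w n.+1).

Lemma childP E F : F \in replacement E <-> exists c, child E c = Some F.
Proof.
case: E => n [] i t; split.
- by rewrite !inE => /or3P[] /eqP->; [exists r1|exists r2|exists s_].
- by case=> -[] //= [<-]; rewrite !inE eqxx ?orbT.
- by rewrite !inE => /or4P[] /eqP->; [exists bm|exists bp|exists u_|exists d_].
- by case=> -[] //= [<-]; rewrite !inE eqxx ?orbT.
Qed.

Lemma child_name E c F : child E c = Some F -> name F = rcons (name E) c.
Proof. by case: E => n [] i t; case: c => //= -[<-]. Qed.

Lemma child_col E c : omap col (child E c) = next_colour (col E) c.
Proof. by case: E => n [] i t; case: c. Qed.

Lemma edge_of_rcons e c : e != [::] ->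
  edge_of (rcons e c) = obind (child^~ c) (edge_of e).
Proof. by case: e => //= c0 v _; rewrite foldl_rcons. Qed.

Lemma edge_of_name e E : edge_of e = Some E -> name E = e.
Proof.
elim/last_ind: e E => // e c IH E.
have [->|e0] := eqVneq e [::]; first by case: c => //= -[<-].
rewrite edge_of_rcons //; case: (edge_of e) IH => //= F /(_ _ erefl) <-.
by move/child_name.
Qed.

Lemma full_expansionP n E :
  E \in full_expansion n <-> edge_of (name E) = Some E /\ size (name E) = n.+1.
Proof.
elim: n E => [|n IH] E.
  split; first by rewrite !inE => /or4P[] /eqP->.
  case=> + sE; move: sE; case: (name E) => [|c [|]] // _.
  by case: c => //= -[<-]; rewrite !inE eqxx ?orbT.
split=> [En|].
  split; last exact: size_name.
  have [F Fn /childP[c cE]] := full_expansionS En.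
  have [eF sF] := (IH F).1 Fn.
  rewrite (child_name cE) edge_of_rcons ?eF //.
  by rewrite -size_eq0 sF.
case; have [v [c nE]] : exists v c, name E = rcons v c \/ name E = [::].
  by case/lastP: (name E) => [|v c]; [exists [::], eL; right|exists v, c; left].
case: nE => [nE|->] //.
rewrite nE; have [->|v0] := eqVneq v [::]; first by [].
rewrite edge_of_rcons //; case vF: (edge_of v) => [F|] //= cE.
rewrite size_rcons => -[sv].
apply/flatten_mapP; exists F; last by apply/childP; exists c.
by apply/IH; rewrite (edge_of_name vF).
Qed.

Lemma names_edge_colP e k : names_edge_col e k <-> colour_of e = Some k.
Proof.
split=> [[G [E [GP EG <- <-]]]|].
  have [n En] := expansion_full GP EG.
  by have [eE _] := (full_expansionP n E).1 En; rewrite /colour_of eE.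
suff ex E : edge_of e = Some E -> exists2 G, expansion G & E \in G.
  rewrite /colour_of; case eE: (edge_of e) => [E|] //= [kE].
  have [G GP EG] := ex _ eE.
  by exists G, E; split=> //; exact: edge_of_name.
elim/last_ind: e E => // e c IH E.
have [->|e0] := eqVneq e [::].
  move=> cE; exists base_graph; first exact: expansion_base.
  by case: c cE => //= -[<-]; rewrite !inE eqxx ?orbT.
rewrite edge_of_rcons //; case eF: (edge_of e) => [F|] //= cE.
have [G GP FG] := IH _ eF.
case/splitPr: FG GP => G1 G2 GP.
exists (G1 ++ replacement F ++ G2); first exact: expansion_replace.
by rewrite !mem_cat (_ : E \in replacement F) ?orbT //; apply/childP; exists c.
Qed.

Lemma names_edgeP e : names_edge e <-> edge_of e.
Proof.
split=> [[k /names_edge_colP]|]; first by rewrite /colour_of; case: (edge_of e).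
case eE: (edge_of e) => [E|] // _; exists (col E); apply/names_edge_colP.
by rewrite /colour_of eE.
Qed.

Lemma colour_of_some e : (colour_of e : bool) = edge_of e.
Proof. by rewrite /colour_of; case: (edge_of e). Qed.

Lemma colour_of_nnil e k : colour_of e = Some k -> e != [::].
Proof. by case: e. Qed.

Lemma run_rcons k v c : run k (rcons v c) = obind (next_colour^~ c) (run k v).
Proof. by rewrite /run foldl_rcons. Qed.

Lemma run_catS k v k' v' : run k v = Some k' -> run k (v ++ v') = run k' v'.
Proof. by rewrite /run foldl_cat => ->. Qed.

Lemma run_prefix k v v' : run k (v ++ v') -> run k v.
Proof.
elim/last_ind: v' => [|v' c IH]; first by rewrite cats0.
by rewrite -rcons_cat run_rcons; case: (run k (v ++ v')) IH => //= ? /(_ isT).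
Qed.

Lemma colour_of_rcons e c : e != [::] ->
  colour_of (rcons e c) = obind (next_colour^~ c) (colour_of e).
Proof.
move=> e0; rewrite /colour_of edge_of_rcons //.
by case: (edge_of e) => //= E; rewrite child_col.
Qed.

Lemma colour_of_cat e v k : colour_of e = Some k -> colour_of (e ++ v) = run k v.
Proof.
move=> ek; elim/last_ind: v => [|v c IH]; first by rewrite cats0.
rewrite -rcons_cat colour_of_rcons ?run_rcons ?IH //.
by apply: contra_neq (colour_of_nnil ek); case: (e).
Qed.

Lemma colour_of_prefix e v : e != [::] -> colour_of (e ++ v) -> colour_of e.
Proof.
move=> e0; elim/last_ind: v => [|v c IH]; first by rewrite cats0.
rewrite -rcons_cat colour_of_rcons; last by apply: contra_neq e0; case: (e).
by case: (colour_of (e ++ v)) IH => //= ? /(_ isT).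
Qed.

Lemma prependl e t n : n < size e -> prepend e t n = nth eL e n.
Proof. by move=> ne; exact: set_nth_default. Qed.

Lemma prependr e t n : prepend e t (size e + n) = t n.
Proof. by rewrite /prepend nth_default ?leq_addr // addKn. Qed.

Lemma prepend_cat e v t : prepend (e ++ v) t = prepend e (prepend v t).
Proof.
apply/funext => n; rewrite /prepend nth_cat size_cat subnDA.
by case: ltnP => ne; [exact: set_nth_default | rewrite [RHS]nth_default].
Qed.

Lemma prepend0 t : prepend [::] t = t.
Proof. by apply/funext=> n; rewrite /prepend nth_nil subn0. Qed.

Lemma prepend_cons c v t n : prepend (c :: v) t n.+1 = prepend v t n.
Proof. by []. Qed.

Lemma mkseq_prepend e t n : mkseq (prepend e t) (size e + n) = e ++ mkseq t n.
Proof.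
apply: (@eq_from_nth _ eL) => [|i]; first by rewrite size_cat !size_mkseq.
rewrite size_mkseq => ie; rewrite nth_mkseq // nth_cat.
case: ltnP => ei; first by rewrite prependl.
rewrite -{1}(subnKC ei) prependr nth_mkseq //.
by rewrite ltn_subLR.
Qed.

Lemma mkseq_cat (t : stream) m n :
  mkseq t (m + n) = mkseq t m ++ mkseq (fun i => t (m + i)) n.
Proof.
rewrite /mkseq iotaD map_cat add0n; congr (_ ++ _).
by rewrite -{1}[m]addn0 iotaDl -map_comp.
Qed.

Lemma prepend_mkseq (w : stream) n : prepend (mkseq w n) (fun i => w (n + i)) = w.
Proof.
apply/funext=> i; case: (ltnP i n) => ni.
  by rewrite prependl ?size_mkseq // nth_mkseq.
by rewrite /prepend nth_default size_mkseq // subnKC.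
Qed.

Lemma valid_prepend e t k : colour_of e = Some k -> valid (prepend e t) <-> valid_tail k t.
Proof.
move=> ek; have e0 : 0 < size e by case: (e) ek => //; rewrite /colour_of.
split=> [vt n|kt n].
  have := vt (size e + n).-1; rewrite prednK ?addn_gt0 ?e0 // mkseq_prepend.
  by rewrite -colour_of_some (colour_of_cat _ ek).
have : colour_of (mkseq (prepend e t) (size e + n.+1)).
  by rewrite mkseq_prepend (colour_of_cat _ ek) kt.
by rewrite addnC mkseq_cat -colour_of_some => /colour_of_prefix; apply.
Qed.

Lemma valid_colour w n : valid w -> exists k, colour_of (mkseq w n.+1) = Some k.
Proof. by move/(_ n); rewrite -colour_of_some; case: (colour_of _) => // k; exists k. Qed.

Lemma prepend_comparable e e' t t' : prepend e t = prepend e' t' ->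
  prefix e e' \/ prefix e' e.
Proof.
move=> ee; wlog se : e e' t t' ee / size e <= size e'.
  by case/orP: (leq_total (size e) (size e')) => se H;
    [apply: H ee _ | apply/or_comm; apply: H (esym ee) _].
left; have := congr1 (fun w : stream => mkseq w (size e)) ee.
rewrite /= -{1}[size e]addn0 mkseq_prepend cats0 => {1}->.
apply/prefixP; exists (drop (size e) e').
rewrite -{1}(cat_take_drop (size e) e'); congr (_ ++ _).
apply: (@eq_from_nth _ eL) => [|i]; rewrite size_takel // ?size_mkseq // => ie.
rewrite nth_mkseq // nth_take // prependl //; exact: leq_trans ie se.
Qed.

(** * The gluing relation *)

Definition glue (w w' : stream) := forall n, exists E F,
  [/\ edge_of (mkseq w n.+1) = Some E, edge_of (mkseq w' n.+1) = Some F &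
      share_vertex E F].

Lemma edge_full e E n : edge_of e = Some E -> size e = n.+1 ->
  E \in full_expansion n.
Proof.
by move=> eE se; apply/full_expansionP; rewrite (edge_of_name eE).
Qed.

Lemma full_edge E n e : E \in full_expansion n -> name E = e ->
  edge_of e = Some E.
Proof. by move=> /full_expansionP[eE _] <-. Qed.

Lemma gluedP (o o' : Omega) : glued o o' <-> glue (val o) (val o').
Proof.
split=> H n; have [E [F]] := H n.
  case=> En Fn nE nF s; exists E, F.
  by split=> //; [exact: full_edge En nE | exact: full_edge Fn nF].
case=> eE eF s; exists E, F; split=> //.
- by apply: edge_full eE _; rewrite size_mkseq.
- by apply: edge_full eF _; rewrite size_mkseq.
- exact: edge_of_name eE.
- exact: edge_of_name eF.
Qed.

Lemma mkseqS (w : stream) n : mkseq w n.+1 = rcons (mkseq w n) (w n).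
Proof. by rewrite /mkseq -[in LHS]addn1 iotaD map_cat cats1. Qed.

Lemma mkseq_nnil (w : stream) n : mkseq w n.+1 != [::].
Proof. by rewrite -size_eq0 size_mkseq. Qed.

Lemma edge_step w n E : edge_of (mkseq w n.+2) = Some E ->
  exists2 E0, edge_of (mkseq w n.+1) = Some E0 & child E0 (w n.+1) = Some E.
Proof.
rewrite mkseqS edge_of_rcons ?mkseq_nnil //.
by case: (edge_of _) => //= E0 cE; exists E0.
Qed.

(** Two distinct edges of the same level that share a vertex after one more
    replacement shared it before: a new vertex belongs to one replaced edge. *)
Lemma shared_old (w w' : stream) n E F E0 F0 v :
  edge_of (mkseq w n.+2) = Some E -> edge_of (mkseq w' n.+2) = Some F ->
  edge_of (mkseq w n.+1) = Some E0 -> edge_of (mkseq w' n.+1) = Some F0 ->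
  mkseq w n.+1 <> mkseq w' n.+1 -> v \in ends E -> v \in ends F ->
  [/\ v \in ends E0, v \in ends F0, v.1 != name E0 & v.1 != name F0].
Proof.
move=> eE eF eE0 eF0 ww'.
have [E1 ] := edge_step eE; rewrite eE0 => -[<-] cE.
have [F1 ] := edge_step eF; rewrite eF0 => -[<-] cF.
apply: (@shared_end_old n).
- by apply: edge_full eE0 _; rewrite size_mkseq.
- by apply: edge_full eF0 _; rewrite size_mkseq.
- apply/eqP => EF; apply: ww'.
  by rewrite -(edge_of_name eE0) -(edge_of_name eF0) EF.
- by apply/childP; eexists; exact: cE.
- by apply/childP; eexists; exact: cF.
Qed.

Lemma valid_edge w n : valid w -> exists E, edge_of (mkseq w n.+1) = Some E.
Proof. by move=> /(_ n); case: (edge_of _) => // E; exists E. Qed.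

(** Sharing a vertex passes from a level to the preceding one. *)
Lemma glue_above N w w' : valid w -> valid w' ->
  (forall n, N <= n -> exists E F,
     [/\ edge_of (mkseq w n.+1) = Some E, edge_of (mkseq w' n.+1) = Some F &
         share_vertex E F]) -> glue w w'.
Proof.
move=> vw vw'; elim: N => [|N IH] H; first by move=> n; exact: H.
apply: IH => n; rewrite leq_eqVlt => /orP[/eqP<-|]; last exact: H.
have [E [F [eE eF [v vE vF]]]] := H N.+1 (leqnn _).
have [E0 eE0] := valid_edge N vw; have [F0 eF0] := valid_edge N vw'.
exists E0, F0; split=> //.
have [ww'|ww'] := pselect (mkseq w N.+1 = mkseq w' N.+1).
  move: eF0; rewrite -ww' eE0 => -[<-]; exists (src E0); exact: mem_head.
by have [v0 v1 _ _] := shared_old eE eF eE0 eF0 ww' vE vF; exists v.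
Qed.

Lemma stream_neq (w w' : stream) : w <> w' ->
  exists k, forall n, k <= n -> mkseq w n.+1 <> mkseq w' n.+1.
Proof.
move=> ww'; have [k wk] : exists k, w k <> w' k.
  by apply/existsNP => H; apply: ww'; exact/funext.
exists k => n kn mm; apply: wk.
by rewrite -(nth_mkseq eL w (_ : k < n.+1)) // mm nth_mkseq.
Qed.

(** Below a red edge, r1 keeps the source only and r2 the target only, so no
    vertex survives the two steps r1 r2.  As a shared vertex would have to
    survive, a word of this form is glued to no other word. *)
Definition alternating (w : stream) :=
  exists N, forall i, w (N + i.*2) = r1 /\ w (N + i.*2).+1 = r2.

Lemma alternating_alone w w' : alternating w -> glue w w' -> w = w'.
Proof.
move=> [N wN] g; apply: contrapT => /stream_neq[k kn].
(* [q] is past the first difference, and the steps after it are r1, r2. *)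
pose q := (N + k.*2).+1.
have [w1 w2] : w q.+1 = r1 /\ w q.+2 = r2.
  by have := wN k.+1; rewrite /q doubleS !addnS.
have [E [F [eE eF [v vE vF]]]] := g q.+2.
have [E1 eE1 cE] := edge_step eE; have [F1 eF1 _] := edge_step eF.
have [E0 eE0 cE1] := edge_step eE1; have [F0 eF0 _] := edge_step eF1.
have kq1 : k <= q.+1 by rewrite /q; lia.
have [vE1 vF1 n1 _] := shared_old eE eF eE1 eF1 (kn _ kq1) vE vF.
have kq : k <= q by rewrite /q; lia.
have [_ _ n0 _] := shared_old eE1 eF1 eE0 eF0 (kn _ kq) vE1 vF1.
move: cE cE1; rewrite w1 w2; case: E0 n0 {eE0} => n [] i t //= n0.
move=> cE -[EE]; move: cE n1 vE; rewrite -EE /= => -[<-] /= n1.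
by rewrite !inE => /orP[]/eqP vv; [move: n1|move: n0]; rewrite vv /= eqxx.
Qed.

(** A tail that makes any edge word alternating: a blue edge is left first
    through [u_], which is red. *)
Definition zigzag (k : colour) : stream := fun n =>
  match k, n with
  | Red, _ => if odd n then r2 else r1
  | Blue, 0 => u_
  | Blue, n.+1 => if odd n then r2 else r1
  end.

Lemma valid_tail_zigzag k : valid_tail k (zigzag k).
Proof.
have red n : run Red (mkseq (zigzag Red) n) = Some Red.
  by elim: n => // n IH; rewrite mkseqS run_rcons IH /=; case: odd.
case: k => [n|[|n]] //; first by rewrite red.
rewrite -add1n mkseq_cat (@run_catS _ _ Red) //.
by have -> : run Red (mkseq (fun i => zigzag Blue (1 + i)) n) = Some Red by exact: red.
Qed.

(** * Reversal of the orientation of a blue edge *)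

Definition flip (c : symbol) : symbol :=
  match c with bm => bp | bp => bm | u_ => d_ | d_ => u_ | c => c end.

(** The reversed map between blue cells changes the first symbol of the tail
    only.  Red tails are not affected, as [flip] fixes r1, r2 and s. *)
Definition flip_first (b : bool) (t : stream) : stream :=
  fun n => if b && (n == 0) then flip (t 0) else t n.

Definition flip_word (b : bool) (v : word) : word :=
  if v is c :: v' then (if b then flip c else c) :: v' else [::].

Lemma flipK : involutive flip. Proof. by case. Qed.

Lemma flip_firstK b : involutive (flip_first b).
Proof. by move=> t; apply/funext => -[|n]; case: b => //=; rewrite /flip_first /= flipK. Qed.

Lemma flip_first0 t : flip_first false t = t. Proof. by []. Qed.

Lemma flip_firstD b b' t : flip_first b (flip_first b' t) = flip_first (b (+) b') t.
Proof.
by apply/funext=> -[|n]; case: b; case: b' => //=; rewrite /flip_first /= ?flipK.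
Qed.

Lemma flip_wordK b : involutive (flip_word b).
Proof. by case=> //= c v; case: b => //; rewrite flipK. Qed.

Lemma flip_word0 v : flip_word false v = v. Proof. by case: v. Qed.

Lemma flip_first_prepend b v t : flip_first b (prepend v t) = prepend (flip_word b v) (flip_first (b && nilp v) t).
Proof.
case: v => [|c v]; first by rewrite /= andbT !prepend0.
by rewrite andbF flip_first0; apply/funext=> -[|n]; case: b.
Qed.

Lemma run_flip k b v : run k (flip_word b v) = run k v.
Proof. by case: v => // c v; case: b => //; case: k; case: c. Qed.

Lemma mkseq_flip b t n : mkseq (flip_first b t) n = flip_word b (mkseq t n).
Proof.
by case: n => // n; rewrite -[n.+1]add1n !mkseq_cat /= /flip_first; case: b.
Qed.

Lemma valid_tail_flip k b t : valid_tail k (flip_first b t) <-> valid_tail k t.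
Proof. by split=> H n; have := H n; rewrite mkseq_flip run_flip. Qed.

Lemma flip_first_red b t : valid_tail Red t -> flip_first b t = t.
Proof.
move=> /(_ 1) H; apply/funext=> -[|n]; rewrite /flip_first ?andbF //.
by case: b => //=; move: H; rewrite /mkseq /=; case: (t 0).
Qed.

Lemma alternating_zigzag e b k : alternating (prepend e (flip_first b (zigzag k))).
Proof.
case: k.
  exists (size e) => i; rewrite -addnS !prependr /flip_first andbF.
  have -> : (if b && (i.*2 == 0) then flip (zigzag Red 0) else zigzag Red i.*2)
      = zigzag Red i.*2 by case: i => //; rewrite ?andbF //; case: b.
  by rewrite /= odd_double.
exists (size e).+1 => i; rewrite addSnnS -addnS !prependr /flip_first !andbF /=.
by rewrite odd_double.
Qed.

(** * The vertices of an edge as points of the limit space *)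

(** Source ([false]) and target ([true]) of an edge, as tails: the source of a
    blue edge is the target of its child [bm], whose own target persists along
    [bp]. *)
Definition end_tail (k : colour) (i : bool) : stream := fun n =>
  match k, i with
  | Red, false => r1
  | Red, true => r2
  | Blue, true => bp
  | Blue, false => if n == 0 then bm else bp
  end.

Definition end_vertex (E : edge) (i : bool) := if i then tgt E else src E.

Definition end_stream (e : word) (i : bool) : stream :=
  prepend e (end_tail (odflt Red (colour_of e)) i).

Lemma valid_tail_end k i : valid_tail k (end_tail k i).
Proof.
have bpn n : run Blue (nseq n bp) = Some Blue by elim: n.
move=> n; suff : run k (mkseq (end_tail k i) n) = Some k by move->.
case: k; case: i; elim: n => // n IH; rewrite mkseqS run_rcons IH //=.
by case: n {IH}.
Qed.

Lemma flip_end_tail b i : flip_first b (end_tail Blue i) = end_tail Blue (b (+) i).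
Proof. by apply/funext=> -[|n]; case: b; case: i. Qed.

(** For a blue edge the source becomes a target after the first step, which
    accounts for the disjunction with [0 < n]. *)
Lemma end_persists e E i n : edge_of e = Some E ->
  exists2 F, edge_of (e ++ mkseq (end_tail (col E) i) n) = Some F &
    end_vertex E i \in ends F.
Proof.
move=> eE; have e0 : e != [::] by case: (e) eE.
suff [F [eF kF vF]] : exists F, [/\
    edge_of (e ++ mkseq (end_tail (col E) i) n) = Some F, col F = col E &
    end_vertex F (if col E is Red then i else (0 < n) || i) = end_vertex E i].
  by exists F => //; rewrite -vF !inE; case: (if _ is Red then _ else _);
    rewrite eqxx ?orbT.
elim: n => [|n [F [eF kF vF]]].
  by exists E; rewrite cats0; split=> //; case: (col E).
rewrite mkseqS -rcons_cat edge_of_rcons; last by move: e0; case: (e).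
rewrite eF /=; case: F kF vF {eF} => m k s t /= kE vF.
case: E {eE} kE vF => m' k' s' t' /= kE; subst k'.
by case: k; case: i; case: n => [|n]; rewrite /end_vertex /= => vF;
  eexists; split=> //=; rewrite ?vF.
Qed.

Lemma end_stream_edge e E i n : edge_of e = Some E -> size e <= n.+1 ->
  exists2 F, edge_of (mkseq (end_stream e i) n.+1) = Some F & end_vertex E i \in ends F.
Proof.
move=> eE /subnKC <-; rewrite /end_stream mkseq_prepend /colour_of eE /=.
exact: end_persists.
Qed.

Lemma valid_end_stream e i : colour_of e -> valid (end_stream e i).
Proof.
case ek: (colour_of e) => [k|] // _; apply/(valid_prepend _ ek).
by rewrite ek; exact: valid_tail_end.
Qed.

(** Deep enough below an edge, the chosen vertex is the only end of the current
    edge that is older than that edge, whereas a shared vertex of two different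
    edges must be old for both. *)
Lemma glue_end_stream e f E F i j : edge_of e = Some E -> edge_of f = Some F ->
  glue (end_stream e i) (end_stream f j) <-> end_vertex E i = end_vertex F j.
Proof.
move=> eE fF.
have ve : valid (end_stream e i) by apply: valid_end_stream; rewrite colour_of_some eE.
have vf : valid (end_stream f j) by apply: valid_end_stream; rewrite colour_of_some fF.
split=> [g|EF]; last first.
  apply: (@glue_above (size e + size f)) => // n efn.
  have [|E1 e1 v1] := end_stream_edge i eE (_ : _ <= n.+1); first by lia.
  have [|F1 f1 v2] := end_stream_edge j fF (_ : _ <= n.+1); first by lia.
  by exists E1, F1; split=> //; exists (end_vertex E i) => //; rewrite EF.
have [k kn] : exists k, end_stream e i = end_stream f j \/
    forall n, k <= n -> mkseq (end_stream e i) n.+1 <> mkseq (end_stream f j) n.+1.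
  have [eq|/stream_neq[k kn]] := pselect (end_stream e i = end_stream f j).
    by exists 0; left.
  by exists k; right.
pose n := k + size e + size f.
have [|E0 e0 v0] := end_stream_edge i eE (_ : _ <= n.+1); first by rewrite /n; lia.
have [|F0 f0 w0] := end_stream_edge j fF (_ : _ <= n.+1); first by rewrite /n; lia.
have [|E1 e1 v1] := end_stream_edge i eE (_ : _ <= n.+2); first by rewrite /n; lia.
have [|F1 f1 w1] := end_stream_edge j fF (_ : _ <= n.+2); first by rewrite /n; lia.
have old x X m l : edge_of x = Some X -> size x <= n ->
    forall Y, edge_of (mkseq (end_stream x l) n.+1) = Some Y ->
    m = end_vertex X l -> m.1 != name Y.
  move=> xX xn Y yY ->; apply: contraTneq xn => mY; rewrite -ltnNge.
  have xS : size x = (size x).-1.+1 by case: (x) xX.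
  have vX : end_vertex X l \in ends X by rewrite !inE; case: l {yY mY}; rewrite eqxx ?orbT.
  have := size_ends (edge_full xX xS) vX.
  by rewrite mY (edge_of_name yY) size_mkseq -xS; lia.
have [E0' ] := edge_step e1; rewrite e0 => -[<-] cE.
have [F0' ] := edge_step f1; rewrite f0 => -[<-] cF.
have oE : (end_vertex E i).1 != name E0.
  by apply: (old e E _ i eE _ _ e0 erefl); rewrite /n; lia.
have oF : (end_vertex F j).1 != name F0.
  by apply: (old f F _ j fF _ _ f0 erefl); rewrite /n; lia.
case: kn => [eq|kn].
  move: f0 f1; rewrite -eq e0 e1 => -[?] [?]; subst F0 F1.
  by apply: (old_end_unique _ v1 w1 oE oF); apply/childP; eexists; exact: cE.
have [E2 [F2 [e2 f2 [v vE vF]]]] := g n.+1.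
move: e2 f2; rewrite e1 f1 => -[?] [?]; subst E2 F2.
have kn' : k <= n by rewrite /n; lia.
have [_ _ nE nF] := shared_old e1 f1 e0 f0 (kn _ kn') vE vF.
rewrite (old_end_unique _ v1 vE oE nE); last by apply/childP; eexists; exact: cE.
by rewrite (old_end_unique _ w1 vF oF nF) //; apply/childP; eexists; exact: cF.
Qed.

Lemma valid_Omega w : valid w <-> Omega_set w.
Proof. by split=> H n; [apply/names_edgeP|apply/names_edgeP]; exact: H. Qed.

Definition leaf_l : stream := end_stream [:: eL] true.

Lemma leaf_l_Omega : Omega_set leaf_l.
Proof. by apply/valid_Omega; exact: valid_end_stream. Qed.

Definition to_Omega (w : stream) : Omega :=
  match pselect (Omega_set w) with
  | left H => SigSub (mem_set H)
  | right _ => SigSub (mem_set leaf_l_Omega)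
  end.

(** [point_of], extended by an arbitrary value to all sequences of symbols, so
    that validity need not be carried by the arguments. *)
Definition pt (w : stream) : airplane := point_of (to_Omega w).

Lemma to_OmegaK w : valid w -> val (to_Omega w) = w.
Proof. by move=> /valid_Omega vw; rewrite /to_Omega; case: pselect. Qed.

Lemma valid_val (o : Omega) : valid (val o).
Proof. by apply/valid_Omega; exact: (set_mem (valP o)). Qed.

Lemma pt_val (o : Omega) : pt (val o) = point_of o.
Proof. by congr point_of; apply: val_inj; rewrite to_OmegaK //; exact: valid_val. Qed.

Lemma point_ofP (o o' : Omega) : point_of o = point_of o' <-> glued o o'.
Proof.
split=> [/eqmodP/asboolP //|g]; exact/eqmodP/asboolP.
Qed.

Lemma ptP w w' : valid w -> valid w' -> pt w = pt w' <-> glue w w'.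
Proof.
move=> vw vw'; split=> [/point_ofP/gluedP|g]; first by rewrite !to_OmegaK.
by apply/point_ofP/gluedP; rewrite !to_OmegaK.
Qed.

Lemma pt_surj p : exists2 w, valid w & p = pt w.
Proof.
exists (val (repr p : Omega)); first exact: valid_val.
by rewrite pt_val /point_of reprK.
Qed.

Lemma pt_alternating w w' : valid w -> valid w' -> alternating w ->
  pt w = pt w' -> w = w'.
Proof. by move=> vw vw' aw /(ptP vw vw'); exact: alternating_alone. Qed.

Lemma pt_end_stream e f E F i j : edge_of e = Some E -> edge_of f = Some F ->
  pt (end_stream e i) = pt (end_stream f j) <-> end_vertex E i = end_vertex F j.
Proof.
move=> eE fF; rewrite -(glue_end_stream i j eE fF); apply: ptP; apply: valid_end_stream.
  by rewrite colour_of_some eE.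
by rewrite colour_of_some fF.
Qed.

(** * Canonical and reversed maps between cells *)

(** The map [f] restricts on the cell of [e] to the canonical ([b = false]) or
    reversed ([b = true]) homeomorphism onto the cell of [e'].  For red edges
    the two agree. *)
Definition carries (f : airplane -> airplane) (e e' : word) (b : bool) :=
  [/\ colour_of e : Prop, colour_of e = colour_of e' &
      forall t, valid (prepend e t) ->
        f (pt (prepend e t)) = pt (prepend e' (flip_first b t))].

Lemma valid_flip e e' b t : colour_of e -> colour_of e = colour_of e' -> valid (prepend e t) ->
  valid (prepend e' (flip_first b t)).
Proof.
case ek: (colour_of e) => [k|] // _ e'k.
by move=> /(valid_prepend _ ek) kt; apply/(valid_prepend _ (esym e'k))/valid_tail_flip.
Qed.

Lemma carries_canonical f e e' : carries f e e' false <-> canonical_on f e e'.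
Proof.
split=> [[oe ee' H]|[[k [/names_edge_colP ek /names_edge_colP e'k]] H]].
  split.
    move: oe ee'; case ek: (colour_of e) => [k|] // _ /esym e'k.
    by exists k; split; apply/names_edge_colP.
  move=> t w w' wt w't; rewrite -!pt_val wt w't; apply: H.
  by rewrite -wt; exact: valid_val.
split; rewrite ?ek ?e'k // => t vt.
apply: (H t); rewrite to_OmegaK //.
by apply: (@valid_flip e e' false); rewrite ?ek ?e'k.
Qed.

Lemma prepend_head e (t : stream) :
  prepend e t = prepend (rcons e (t 0)) (fun n => t n.+1).
Proof.
by rewrite -cats1 prepend_cat; congr prepend; apply/funext=> -[|n] //;
  rewrite prepend_cons prepend0.
Qed.

Lemma reversed_carries f e e' : reversed_on f e e' -> carries f e e' true.
Proof.
move=> [/names_edge_colP ek /names_edge_colP e'k H].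
split; rewrite ?ek ?e'k // => t vt.
have vt' : valid (prepend e' (flip_first true t)).
  by apply: (@valid_flip e e'); rewrite ?ek ?e'k.
apply: (H (t 0) (flip (t 0)) _ (fun n => t n.+1)); rewrite ?to_OmegaK //.
- have := (valid_prepend t ek).1 vt 1; rewrite /mkseq /=.
  by case: (t 0); rewrite // !inE eqxx ?orbT.
- exact: prepend_head.
- by rewrite prepend_head.
Qed.

Lemma carries_col f e e' b : carries f e e' b -> colour_of e = colour_of e'.
Proof. by case. Qed.

Lemma carries_ext f e e' b v : carries f e e' b -> colour_of (e ++ v) ->
  carries f (e ++ v) (e' ++ flip_word b v) (b && nilp v).
Proof.
move=> [oe ee' H] ov; split=> //.
  by move: oe ee'; case ek: (colour_of e) => [k|] // _ /esym e'k;
    rewrite (colour_of_cat _ ek) (colour_of_cat _ e'k) run_flip.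
move=> t; rewrite prepend_cat => /H ->.
by rewrite prepend_cat flip_first_prepend.
Qed.

Lemma carries_ext0 f e e' v : carries f e e' false -> colour_of (e ++ v) ->
  carries f (e ++ v) (e' ++ v) false.
Proof. by move=> H /(carries_ext H); rewrite flip_word0. Qed.

Lemma carries_red f e e' b : colour_of e = Some Red -> carries f e e' b -> carries f e e' false.
Proof.
move=> er [oe ee' H]; split=> // t vt; rewrite H //.
by rewrite !flip_first_red //; apply/(valid_prepend _ er).
Qed.

Lemma carries_comp f g e e' e'' b b' : carries g e e' b -> carries f e' e'' b' ->
  carries (f \o g) e e'' (b' (+) b).
Proof.
move=> [oe ee' H] [_ ee'' H']; split=> //; first by rewrite ee'.
move=> t vt; rewrite /= H // H' ?flip_firstD //; exact: valid_flip vt.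
Qed.

Lemma carries_inv (f g : airplane -> airplane) e e' b : cancel f g ->
  carries f e e' b -> carries g e' e b.
Proof.
move=> fK [oe ee' H]; split=> //; first by rewrite -ee'.
move=> t vt; have vt' : valid (prepend e (flip_first b t)).
  by apply: valid_flip vt => //; rewrite -ee'.
by rewrite -[in RHS](fK (pt _)) H // flip_firstK.
Qed.

Lemma valid_zigzag e k b : colour_of e = Some k -> valid (prepend e (flip_first b (zigzag k))).
Proof. by move=> ek; apply/(valid_prepend _ ek)/valid_tail_flip; exact: valid_tail_zigzag. Qed.

(** An alternating word below [e] has one preimage, whose only name begins with
    both [e1] and [e2]. *)
Lemma carries_comparable (f : homeo airplane) e1 e2 e b1 b2 :
  carries f e1 e b1 -> carries f e2 e b2 -> prefix e1 e2 \/ prefix e2 e1.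
Proof.
move=> /(carries_inv (homeo_funK f))[oe1 ee1 H1] /(carries_inv (homeo_funK f))[_ ee2 H2].
case ek: (colour_of e) oe1 ee1 ee2 => [k|] // _ /esym e1k /esym e2k.
have := H1 _ (valid_zigzag false ek); rewrite H2; last exact: valid_zigzag.
move/(pt_alternating (valid_zigzag _ e2k) (valid_zigzag _ e1k)
  (alternating_zigzag _ _ _)).
by move/prepend_comparable/or_comm.
Qed.

Lemma homeo_ext (f g : homeo airplane) (P : seq word) :
  (forall w, valid w -> exists2 e, e \in P & exists t, w = prepend e t) ->
  (forall e, e \in P -> exists e' b, carries f e e' b /\ carries g e e' b) -> f = g.
Proof.
move=> cov H; apply: homeo_eqP => p; have [w vw ->] := pt_surj p.
have [e eP [t wt]] := cov w vw; have [e' [b [[_ _ fe] [_ _ ge]]]] := H e eP.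
by move: vw; rewrite wt => vt; rewrite fe // ge.
Qed.

(** * Rearrangements and the levels of the full expansions *)

(** A form of membership in [T_A] without interiors, convenient for products. *)
Definition level_linear (f : airplane -> airplane) n :=
  forall e, colour_of e -> n < size e -> exists e', carries f e e' false.

Lemma cell_prefix e w : colour_of e -> valid w -> alternating w ->
  cell e (pt w) -> exists t, w = prepend e t.
Proof.
move=> oe vw aw [o [t ot]] opt; exists t.
apply: pt_alternating; rewrite -?ot ?pt_val ?opt //; exact: valid_val.
Qed.

(** The alternating word below a deep edge [e] lies in a cell of the partition,
    and its only name then begins with the name of that cell. *)
Lemma T_A_level (f : homeo airplane) : T_A f -> exists n, level_linear f n.
Proof.
move=> [P [PE Pcov _] Pf]; exists (\max_(e <- P) size e) => e oe se.
case ek: (colour_of e) (oe) => [k|] // _.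
have vw := valid_zigzag false ek.
have [e0 e0P /cell_prefix] := Pcov (pt (prepend e (flip_first false (zigzag k)))).
case=> //; first by rewrite colour_of_some; apply/names_edgeP; exact: PE.
  exact: alternating_zigzag.
move=> t /prepend_comparable pe.
have {pe} : prefix e0 e.
  case: pe => // /prefixP[v ev]; move: se; rewrite ltnNge => /negP[].
  apply: leq_trans (leq_bigmax_seq _ e0P isT).
  by rewrite ev size_cat leq_addr.
move=> /prefixP[v ev]; have [e' /carries_canonical e0e'] := Pf _ e0P.
by exists (e' ++ v); rewrite ev; apply: carries_ext0 => //; rewrite -ev.
Qed.

Definition cylinder (t : stream) N : set symbol_sequences :=
  [set w | forall i, i < N -> w i = t i].

Lemma cylinder_filter t : Filter (filter_from setT (cylinder t)).
Proof.
apply: filter_from_filter; first by exists 0.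
move=> m n _ _; exists (maxn m n) => // w H; split=> i il; apply: H;
  rewrite leq_max il ?orbT //.
Qed.

Lemma cylinder_nbhs (o : Omega) (A : set Omega) : nbhs o A ->
  exists N, forall o' : Omega, mkseq (val o') N = mkseq (val o) N -> A o'.
Proof.
rewrite nbhsE => -[_ [[B oB <-] /= Bo] BA].
have fF := cylinder_filter (val o).
have cF : filter_from setT (cylinder (val o)) --> (val o : symbol_sequences).
  apply/cvg_sup => i C [_ [[D oD <-] /= Dt] DC].
  exists i.+1 => // w H; apply: DC => /=; rewrite H //.
have : nbhs (val o : symbol_sequences) B by exact: open_nbhs_nbhs.
move/cF => [N _ NB]; exists N => o' oo'; apply: BA => /=; apply: NB => i iN.
by have := congr1 (nth eL ^~ i) oo'; rewrite !nth_mkseq.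
Qed.

Lemma prefix_eq (e e' : word) : prefix e e' -> size e = size e' -> e = e'.
Proof. by rewrite prefixE => /eqP + se; rewrite se take_size. Qed.

(** A common interior point has alternating words nearby, and such a word begins
    with the names of both cells. *)
Lemma interior_common (e e' : word) (p : airplane) :
  edge_of e -> edge_of e' -> (cell e)° p -> (cell e')° p ->
  prefix e e' \/ prefix e' e.
Proof.
move=> oe oe' ep e'p; have [w vw pw] := pt_surj p.
pose U := (cell e)° `&` (cell e')°.
have oU : open U by apply: openI; exact: open_interior.
have /cylinder_nbhs[N NU] : nbhs (to_Omega w) ((@point_of) @^-1` U).
  apply: open_nbhs_nbhs; split; first exact: oU.
  by rewrite /= -/(pt w) -pw.
have [k wk] := valid_colour N vw.
pose w' := prepend (mkseq w N.+1) (flip_first false (zigzag k)).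
have vw' : valid w' := valid_zigzag false wk.
have aw' : alternating w' := alternating_zigzag _ _ _.
have : U (pt w').
  apply: NU; rewrite !to_OmegaK //.
  apply: (@eq_from_nth _ eL); rewrite !size_mkseq // => i iN.
  rewrite !nth_mkseq // /w' prependl ?size_mkseq ?nth_mkseq //; exact: leqW.
case=> /interior_subset/cell_prefix-/(_ _ _ _)[] //; rewrite ?colour_of_some // => t wt.
case/interior_subset/cell_prefix => //; rewrite ?colour_of_some // => t' wt'.
by apply: (@prepend_comparable _ _ t t'); rewrite -wt.
Qed.

Lemma level_T_A (f : homeo airplane) n : level_linear f n -> T_A f.
Proof.
move=> fn; exists [seq name E | E <- full_expansion n].
  split=> [e /mapP[E /full_expansionP[eE _] ->]|p|e e'].
  - by apply/names_edgeP; rewrite eE.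
  - have [w vw ->] := pt_surj p; have [E eE] := valid_edge n vw.
    exists (mkseq w n.+1).
      apply/mapP; exists E; last by rewrite (edge_of_name eE).
      by apply: edge_full eE _; rewrite size_mkseq.
    exists (to_Omega w) => //; exists (fun i => w (n.+1 + i)).
    by rewrite to_OmegaK // prepend_mkseq.
  - move=> /mapP[E En ->] /mapP[F Fn ->] EF; apply/seteqP; split=> // p [pE pF].
    have [[eE sE] [eF sF]] := ((full_expansionP _ _).1 En, (full_expansionP _ _).1 Fn).
    have : prefix (name E) (name F) \/ prefix (name F) (name E).
      by apply: interior_common pE pF; rewrite ?eE ?eF.
    have sEF : size (name E) = size (name F) by rewrite sE sF.
    by case=> /prefix_eq pre; move/eqP: EF; apply; [|apply/esym]; exact: pre.
move=> e /mapP[E /full_expansionP[eE sE] ->].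
have [||e' /carries_canonical] := fn (name E); rewrite ?colour_of_some ?eE ?sE //.
by exists e'.
Qed.

Lemma level_comp (f g : airplane -> airplane) m n :
  level_linear f m -> level_linear g n -> level_linear (f \o g) (n + m.+1).
Proof.
move=> fm gn e oe se.
pose a := take n.+1 e; pose v := drop n.+1 e.
have ev : e = a ++ v by rewrite cat_take_drop.
have sa : size a = n.+1 by rewrite size_takel //; lia.
have oa : colour_of a by apply: (@colour_of_prefix a v); rewrite -?ev // -size_eq0 sa.
have [|a' aa'] := gn a oa; first by rewrite sa.
have ea := carries_ext0 aa' (_ : colour_of (a ++ v)); rewrite -ev in ea.
have [||b H] := fm (a' ++ v); first by rewrite -(carries_col (ea oe)).
  by rewrite size_cat; move: se; rewrite ev size_cat sa; lia.
by exists b; exact: (carries_comp (ea oe) H).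
Qed.

Lemma T_A_comp (f g : homeo airplane) : T_A f -> T_A g -> T_A (f * g)%g.
Proof.
move=> /T_A_level[m fm] /T_A_level[n gn].
by apply: (@level_T_A (f * g)%g (n + m.+1)); exact: level_comp.
Qed.

(** * Expansions as trees, and tables of rearrangements *)

(** Expansions of one red edge and of one blue edge; the children are in the
    order r1, r2, s and bm, bp, u, d. *)
Inductive rtree := RL | RN of rtree & rtree & btree
with btree := BL | BN of btree & btree & rtree & rtree.

Scheme rtree_mut := Induction for rtree Sort Prop
with btree_mut := Induction for btree Sort Prop.
Combined Scheme tree_mut from rtree_mut, btree_mut.

Definition below (e : word) (X : seq word) : seq word := [seq e ++ v | v <- X].

Fixpoint rleaves (t : rtree) : seq word :=
  if t is RN a b s then
    below [:: r1] (rleaves a) ++ below [:: r2] (rleaves b) ++ below [:: s_] (bleaves s)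
  else [:: [::]]
with bleaves (t : btree) : seq word :=
  if t is BN a b u d then
    below [:: bm] (bleaves a) ++ below [:: bp] (bleaves b) ++
    below [:: u_] (rleaves u) ++ below [:: d_] (rleaves d)
  else [:: [::]].

(** An expansion of the base graph. *)
Record forest := Forest { inL : btree; inR : btree; inU : rtree; inD : rtree }.

Definition leaves (Q : forest) : seq word :=
  below [:: eL] (bleaves (inL Q)) ++ below [:: eR] (bleaves (inR Q)) ++
  below [:: eU] (rleaves (inU Q)) ++ below [:: eD] (rleaves (inD Q)).

Lemma below_below e e' X : below e (below e' X) = below (e ++ e') X.
Proof. by rewrite /below -map_comp; apply: eq_map => v /=; rewrite catA. Qed.

Lemma below_cat e X Y : below e (X ++ Y) = below e X ++ below e Y.
Proof. exact: map_cat. Qed.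

Lemma mem_below c c' v X : (c :: v \in below [:: c'] X) = (c == c') && (v \in X).
Proof.
apply/mapP/andP => [[v' v'X [-> ->]]|[/eqP-> vX]]; first by rewrite eqxx.
by exists v.
Qed.

Lemma nil_below c X : ([::] \in below [:: c] X) = false.
Proof. by apply/mapP => -[]. Qed.

Lemma tree_leaves_colour :
  (forall t v, v \in rleaves t -> run Red v) /\
  (forall t v, v \in bleaves t -> run Blue v).
Proof.
apply: (@tree_mut (fun t => forall v, v \in rleaves t -> run Red v : Prop)
  (fun t => forall v, v \in bleaves t -> run Blue v : Prop)).
- by move=> v /=; rewrite inE => /eqP->.
- move=> a Ha b Hb s Hs [|c v] //=; rewrite !mem_cat !mem_below.
  by case/or3P=> /andP[/eqP-> ]; [move/Ha|move/Hb|move/Hs].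
- by move=> v /=; rewrite inE => /eqP->.
- move=> a Ha b Hb u Hu d Hd [|c v] //=; rewrite !mem_cat !mem_below.
  by case/or4P=> /andP[/eqP-> ]; [move/Ha|move/Hb|move/Hu|move/Hd].
Qed.

Lemma leaves_colour Q e : e \in leaves Q -> colour_of e.
Proof.
have catE k c v : colour_of [:: c] = Some k -> colour_of (c :: v) = run k v.
  by move=> ck; rewrite -cat1s; apply: colour_of_cat.
have [Hr Hb] := tree_leaves_colour.
rewrite /leaves !mem_cat; case: e => [|c v]; first by rewrite !nil_below.
rewrite !mem_below.
by case/or4P=> /andP[/eqP->]; [move/Hb|move/Hb|move/Hr|move/Hr];
  [rewrite (catE Blue)|rewrite (catE Blue)|rewrite (catE Red)|rewrite (catE Red)].
Qed.

Definition half_table (f : airplane -> airplane) (Q Q' : forest) :=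
  forall e, e \in leaves Q ->
  exists2 e', e' \in leaves Q' & exists b, carries f e e' b.

(** Symmetric in [f] and its inverse, so that [Q'] is exactly the image of [Q]. *)
Definition table (f : homeo airplane) (Q Q' : forest) :=
  half_table f Q Q' /\ half_table (homeo_inv f) Q' Q.

Lemma table_inv f Q Q' : table f Q Q' -> table (f^-1)%g Q' Q.
Proof. by case. Qed.

Lemma half_table_comp f g Q Q' Q'' :
  half_table g Q Q' -> half_table f Q' Q'' -> half_table (f \o g) Q Q''.
Proof.
move=> gQ fQ e /gQ[e' /fQ[e'' e''Q [b' ee''] [b ee']]].
by exists e'' => //; exists (b' (+) b); exact: carries_comp ee' ee''.
Qed.

Lemma table_comp (f g : homeo airplane) Q Q' Q'' :
  table g Q Q' -> table f Q' Q'' -> table (f * g)%g Q Q''.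
Proof.
move=> [g1 g2] [f1 f2]; split; first exact: half_table_comp g1 f1.
exact: half_table_comp f2 g2.
Qed.

Lemma carries_id e : colour_of e -> carries id e e false. Proof. by []. Qed.

Lemma table1 Q : table 1%g Q Q.
Proof.
by split=> e eQ; exists e => //; exists false; apply: carries_id;
  exact: leaves_colour eQ.
Qed.

(** The tree of the image under a reversed map. *)
Definition flip_tree (t : btree) : btree :=
  if t is BN a b u d then BN b a d u else BL.

Lemma bleaves_flip t : bleaves (flip_tree t) =i [seq flip_word true v | v <- bleaves t].
Proof.
case: t => //= a b u d v; rewrite !map_cat !mem_cat /below -!map_comp.
have E c c' X : flip c = c' ->
    (v \in [seq [:: c'] ++ w | w <- X]) = (v \in [seq (flip_word true \o cat [:: c]) w | w <- X]).
  by move=> <-.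
rewrite -!(E bm bp, E bp bm, E u_ d_, E d_ u_) //.
by rewrite orbCA; congr (_ || (_ || _)); exact: orbC.
Qed.

Lemma mem_below_flip e t w :
  (w \in below e (bleaves (flip_tree t))) = (w \in below e [seq flip_word true v | v <- bleaves t]).
Proof.
by apply/mapP/mapP => -[v vt ->]; exists v => //; move: vt; rewrite bleaves_flip.
Qed.

(** How the tables of a generator are obtained: [s] lists cells that are carried
    to cells, each with the leaves that the domain has beneath it. *)
Lemma table_pieces (f : homeo airplane) (s : seq (word * word * bool * seq word))
  Q Q' :
  (forall e e' b X, (e, e', b, X) \in s -> carries f e e' b) ->
  leaves Q =i flatten [seq below p.1.1.1 p.2 | p <- s] ->
  leaves Q' =i flatten [seq below p.1.1.2 [seq flip_word p.1.2 v | v <- p.2] | p <- s] ->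
  table f Q Q'.
Proof.
move=> fs QE Q'E; split=> e eQ; have := eQ.
  rewrite QE => /flatten_mapP[[[[a a'] b] X] ps /mapP[v vX ev]].
  exists (a' ++ flip_word b v); last first.
    by exists (b && nilp v); rewrite ev; apply: carries_ext (fs _ _ _ _ ps) _;
      rewrite -[a ++ v]ev; exact: leaves_colour eQ.
  rewrite Q'E; apply/flatten_mapP; exists (a, a', b, X) => //.
  by apply/mapP; exists (flip_word b v) => //; exact: map_f.
rewrite Q'E => /flatten_mapP[[[[a a'] b] X] ps /mapP[_ /mapP[v vX ->] ev]].
exists (a ++ v).
  by rewrite QE; apply/flatten_mapP; exists (a, a', b, X) => //; exact: map_f.
exists (b && nilp (flip_word b v)).
rewrite ev -[in X in carries _ _ (a ++ X)](flip_wordK b v).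
apply: carries_ext (carries_inv (homeo_funK f) (fs _ _ _ _ ps)) _.
by rewrite -[_ ++ _]ev; exact: leaves_colour eQ.
Qed.

Lemma trees_cover :
  (forall T t, valid_tail Red t -> exists2 v, v \in rleaves T & exists t', t = prepend v t') /\
  (forall T t, valid_tail Blue t -> exists2 v, v \in bleaves T & exists t', t = prepend v t').
Proof.
pose P k X := forall t, valid_tail k t -> exists2 v : word, v \in (X : seq word) &
  exists t', t = prepend v t'.
have leaf k : P k [:: [::]].
  by move=> t _; exists [::]; [exact: mem_head | exists t; rewrite prepend0].
have node k (X : seq word) :
    (forall c, next_colour k c -> exists k' Y, [/\ next_colour k c = Some k', P k' Y &
       {subset below [:: c] Y <= X}]) -> P k X.
  move=> H t kt; have /H[k' [Y [kc PY YX]]] : next_colour k (t 0).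
    by have := kt 1.
  have [|v vY [t' tt']] := PY (fun n => t n.+1).
    move=> n; have := kt (1 + n); rewrite mkseq_cat (@run_catS _ _ k') //.
  exists (t 0 :: v); first by apply: YX; rewrite mem_below eqxx.
  by exists t'; apply/funext => -[|n] //; rewrite prepend_cons -tt'.
apply: (@tree_mut (fun T => P Red (rleaves T)) (fun T => P Blue (bleaves T)));
  try exact: leaf.
- move=> a Ha b Hb s Hs; apply: node => -[] //= _.
  + by exists Red, (rleaves a); split=> // v; rewrite !mem_cat => ->.
  + by exists Red, (rleaves b); split=> // v; rewrite !mem_cat => ->; rewrite orbT.
  + by exists Blue, (bleaves s); split=> // v; rewrite !mem_cat => ->; rewrite !orbT.
- move=> a Ha b Hb u Hu d Hd; apply: node => -[] //= _.
  + by exists Blue, (bleaves a); split=> // v; rewrite !mem_cat => ->.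
  + by exists Blue, (bleaves b); split=> // v; rewrite !mem_cat => ->; rewrite orbT.
  + by exists Red, (rleaves u); split=> // v; rewrite !mem_cat => ->; rewrite !orbT.
  + by exists Red, (rleaves d); split=> // v; rewrite !mem_cat => ->; rewrite !orbT.
Qed.

Lemma leaves_cover Q w : valid w ->
  exists2 e, e \in leaves Q & exists t, w = prepend e t.
Proof.
move=> vw; have w0 := vw 0; have [Hr Hb] := trees_cover.
have wE t c : w 0 = c -> (fun n => w n.+1) = t -> w = prepend [:: c] t.
  by move=> <- <-; apply/funext=> -[|n] //; rewrite prepend_cons prepend0.
have okw k : colour_of [:: w 0] = Some k -> valid_tail k (fun n => w n.+1).
  by move=> ck; apply/(valid_prepend _ ck); rewrite -(wE _ _ erefl erefl).
move: w0; rewrite /mkseq /=; case wc: (w 0) okw => // okw _.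
- have [v vL [t wt]] := Hb (inL Q) _ (okw _ erefl).
  exists (eL :: v); first by rewrite !mem_cat mem_below vL.
  by exists t; rewrite -cat1s prepend_cat; exact: wE.
- have [v vL [t wt]] := Hb (inR Q) _ (okw _ erefl).
  exists (eR :: v); first by rewrite !mem_cat !mem_below vL.
  by exists t; rewrite -cat1s prepend_cat; exact: wE.
- have [v vL [t wt]] := Hr (inU Q) _ (okw _ erefl).
  exists (eU :: v); first by rewrite !mem_cat !mem_below vL.
  by exists t; rewrite -cat1s prepend_cat; exact: wE.
- have [v vL [t wt]] := Hr (inD Q) _ (okw _ erefl).
  exists (eD :: v); first by rewrite !mem_cat !mem_below vL.
  by exists t; rewrite -cat1s prepend_cat; exact: wE.
Qed.

Lemma half_table_level f Q Q' : half_table f Q Q' ->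
  level_linear f (\max_(e <- leaves Q) size e).+1.
Proof.
move=> fQ e oe se; case ek: (colour_of e) (oe) => [k|] // _.
have [e0 e0Q [t]] := leaves_cover Q (valid_zigzag false ek).
move/prepend_comparable => pe.
have se0 : size e0 < size e.
  by apply: leq_trans (leq_ltn_trans _ se) (leqnn _); apply: leqW;
    exact: leq_bigmax_seq _ e0Q isT.
have {pe} : prefix e0 e.
  case: pe => // /prefixP[v ev]; move: se0.
  by rewrite ltnNge ev size_cat leq_addr.
case/prefixP=> v ev; have [e1 _ [b e01]] := fQ _ e0Q.
exists (e1 ++ flip_word b v); have := carries_ext e01 (_ : colour_of (e0 ++ v)).
have -> : nilp v = false.
  by apply/negbTE/negP => /nilP v0; move: se0; rewrite ev v0 cats0 ltnn.
by rewrite andbF -ev; exact.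
Qed.

(** The smallest tree at [q] whose leaves lie in [X] or at depth [n]. *)
Fixpoint rcut (X : pred word) n (q : word) {struct n} : rtree :=
  if X q then RL else
  if n is n'.+1 then RN (rcut X n' (rcons q r1)) (rcut X n' (rcons q r2))
                        (bcut X n' (rcons q s_))
  else RL
with bcut (X : pred word) n (q : word) {struct n} : btree :=
  if X q then BL else
  if n is n'.+1 then BN (bcut X n' (rcons q bm)) (bcut X n' (rcons q bp))
                        (rcut X n' (rcons q u_)) (rcut X n' (rcons q d_))
  else BL.

Definition cut_leaf (X : pred word) n k (q v : word) :=
  [/\ run k v : Prop, size v <= n, X (q ++ v) \/ size v = n &
      forall v' v'', v = v' ++ v'' -> v'' <> [::] -> ~~ X (q ++ v')].

Lemma cut_leafP X n :
  (forall q v, v \in rleaves (rcut X n q) <-> cut_leaf X n Red q v) /\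
  (forall q v, v \in bleaves (bcut X n q) <-> cut_leaf X n Blue q v).
Proof.
have stop q k m v : X q \/ m = 0 -> v \in [:: [::]] <-> cut_leaf X m k q v.
  move=> Xq; rewrite inE; split=> [/eqP->|[_ sv xv nx]].
    split=> //; first by rewrite cats0; case: Xq => [|->]; [left|right].
    by case=> // -[].
  case: Xq => [Xq|m0]; last by move: sv; rewrite m0 leqn0 size_eq0.
  by case: v nx {sv xv} => // c v /(_ [::] _ erefl); rewrite cats0 Xq; case.
have step q k m c v : ~~ X q ->
    cut_leaf X m.+1 k q (c :: v) <->
    exists2 k', next_colour k c = Some k' & cut_leaf X m k' (rcons q c) v.
  move=> Xq; split=> [[kv sv xv nx]|[k' kc [kv sv xv nx]]].
    case kc: (next_colour k c) => [k'|]; last first.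
      by move: kv; rewrite -cat1s => /run_prefix; rewrite /run /= kc.
    exists k' => //; split=> //.
    - by move: kv; rewrite -cat1s (@run_catS _ _ k').
    - by rewrite cat_rcons; case: xv => [|[]]; [left|right].
    - by move=> v' v'' vv v''0; rewrite cat_rcons; apply: (nx _ v'') => //; rewrite vv.
  split=> //.
  - by rewrite -cat1s (@run_catS _ _ k').
  - by rewrite -cat_rcons; case: xv => [|<-]; [left|right].
  - case=> [|c' v'] v''; first by rewrite cats0.
    by case=> <- vv v''0; rewrite -cat_rcons; apply: nx vv v''0.
elim: n => [|n [IHr IHb]]; split=> q v /=.
- by case: ifP => Xq; apply: stop; rewrite ?Xq; [left|right].
- by case: ifP => Xq; apply: stop; rewrite ?Xq; [left|right].
- case: ifP => Xq; first by apply: stop; left.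
  rewrite !mem_cat; case: v => [|c v].
    by rewrite !nil_below; split=> // -[_ _ []] //; rewrite cats0 Xq.
  rewrite !mem_below; split=> [|/step[|k' kc H]]; last 2 first.
  + by rewrite Xq.
  + by case: c kc H => //= -[<-] H; rewrite ?(IHr _ _).2 ?(IHb _ _).2 //= ?orbT.
  by case/or3P=> /andP[/eqP-> H]; apply/step; rewrite ?Xq //;
    eexists=> //; [apply/IHr|apply/IHr|apply/IHb].
- case: ifP => Xq; first by apply: stop; left.
  rewrite !mem_cat; case: v => [|c v].
    by rewrite !nil_below; split=> // -[_ _ []] //; rewrite cats0 Xq.
  rewrite !mem_below; split=> [|/step[|k' kc H]]; last 2 first.
  + by rewrite Xq.
  + by case: c kc H => //= -[<-] H; rewrite ?(IHr _ _).2 ?(IHb _ _).2 //= ?orbT.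
  by case/or4P=> /andP[/eqP-> H]; apply/step; rewrite ?Xq //;
    eexists=> //; [apply/IHb|apply/IHb|apply/IHr|apply/IHr].
Qed.

Definition fcut (X : pred word) n : forest :=
  Forest (bcut X n [:: eL]) (bcut X n [:: eR]) (rcut X n [:: eU]) (rcut X n [:: eD]).

Lemma fcutP X n e : e \in leaves (fcut X n) <->
  [/\ colour_of e : Prop, size e <= n.+1, X e \/ size e = n.+1 &
      forall v v', e = v ++ v' -> v != [::] -> v' <> [::] -> ~~ X v].
Proof.
have [Hr Hb] := cut_leafP X n.
case: e => [|c v]; first by rewrite !mem_cat !nil_below; split=> // -[].
have H k : colour_of [:: c] = Some k -> cut_leaf X n k [:: c] v <->
  [/\ colour_of (c :: v) : Prop, size (c :: v) <= n.+1,
      X (c :: v) \/ size (c :: v) = n.+1 &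
      forall u u', c :: v = u ++ u' -> u != [::] -> u' <> [::] -> ~~ X u].
  move=> ck; split=> -[kv sv xv nx]; split=> //.
  - by rewrite -cat1s (colour_of_cat _ ck).
  - by case: xv => [|<-]; [left|right].
  - by case=> // c' u u' [<-] vv _ u'0; exact: nx vv u'0.
  - by move: kv; rewrite -cat1s (colour_of_cat _ ck).
  - by case: xv => [|[<-]]; [left|right].
  - by move=> u u' vv u'0; apply: (nx _ u') => //; rewrite vv.
rewrite !mem_cat !mem_below; split.
  by case/or4P=> /andP[/eqP ?]; subst c; [move/Hb|move/Hb|move/Hr|move/Hr]; move/H; exact.
move=> C; have : colour_of [:: c].
  by case: C => + _ _ _; rewrite -cat1s; apply: colour_of_prefix.
case: c C H => // C H _; move: C => /(H _ erefl); rewrite /= ?orbF.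
- by move/Hb.
- by move/Hb.
- by move/Hr.
- by move/Hr.
Qed.

(** The range tree is cut at the images of the edges of a full expansion.  These
    images are pairwise incomparable and meet every long word, since [f] is
    injective and surjective on points with a unique name. *)
Lemma T_A_table f : T_A f -> exists Q Q', table f Q Q'.
Proof.
move=> /T_A_level[n fn]; pose Q := fcut (fun e => size e == n.+1) n.
have QP e : e \in leaves Q <-> colour_of e /\ size e = n.+1.
  split=> [/fcutP[oe _ se _]|[oe se]]; first by split=> //; case: se => // /eqP.
  apply/fcutP; split=> //; [by rewrite se|by right|].
  move=> v v' ev _ /nilP v'0; apply/eqP => vn; move: se.
  by rewrite ev size_cat vn; case: v' v'0 {ev} => //= *; lia.
have [phi phiP] : exists phi, forall e, e \in leaves Q -> carries f e (phi e) false.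
  have [|phi H] := @choice _ _ (fun e e' => e \in leaves Q -> carries f e e' false).
    move=> e; have [eQ|] := pselect (e \in leaves Q : Prop); last by exists [::].
    have [oe se] := (QP e).1 eQ.
    by have [|e' ee'] := fn e oe; [rewrite se|exists e'].
  by exists phi.
pose X := [seq phi e | e <- leaves Q].
pose N := \max_(e <- X) size e.
have XN q : q \in X -> size q <= N by move=> qX; exact: leq_bigmax_seq qX isT.
have Xcol q : q \in X -> colour_of q.
  by move=> /mapP[e eQ ->]; have [oe <- _] := phiP _ eQ.
(* No image of an edge lies below another one. *)
have anti q v : q \in X -> q ++ v \in X -> v = [::].
  move=> /mapP[e eQ eq] /mapP[e' e'Q eq'].
  have L := carries_ext0 (phiP _ eQ) (_ : colour_of (e ++ v)).
  have L' := phiP _ e'Q; rewrite -eq' eq in L'.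
  have ov : colour_of (e ++ v).
    have := Xcol _ (map_f phi e'Q); rewrite -eq' eq.
    have [] := phiP _ eQ; case ek: (colour_of e) => [k|] // _ /esym pk _.
    by rewrite (colour_of_cat _ pk) (colour_of_cat _ ek).
  have se : size e = size e' by rewrite ((QP e).1 eQ).2 ((QP e').1 e'Q).2.
  have : e = e'.
    case: (carries_comparable (L ov) L') => /prefixP[u].
      move=> H; have := congr1 size H; rewrite !size_cat -se => hu.
      have /nilP v0 : nilp v by rewrite /nilp; lia.
      have /nilP u0 : nilp u by rewrite /nilp; lia.
      by move: H; rewrite u0 v0 !cats0.
    move=> H; have := congr1 (take (size e)) H.
    by rewrite take_size_cat // se take_size_cat.
  move=> ee; subst e'; have := congr1 size eq'; rewrite -eq size_cat => hv.
  by apply/nilP; rewrite /nilp; lia.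
exists Q, (fcut (fun e => e \in X) N); split=> e.
  move=> eQ; exists (phi e); last by exists false; exact: phiP.
  have pX : phi e \in X by exact: map_f.
  apply/fcutP; split; [exact: Xcol|exact: leqW (XN _ pX)|by left|].
  by move=> v v' pe _ v'0; apply/negP => vX; apply: v'0; apply: (anti v) => //; rewrite -pe.
case/fcutP=> oe se eX nx.
suff /mapP[e' e'Q ->] : e \in X.
  by exists e' => //; exists false; exact: carries_inv (homeo_funK f) (phiP _ e'Q).
case: eX => // seN; case ek: (colour_of e) (oe) => [k|] // _.
have vw := valid_zigzag false ek.
have [w0 vw0 w0E] := pt_surj (homeo_inv f (pt (prepend e (flip_first false (zigzag k))))).
have [e0 e0Q [t w0t]] := leaves_cover Q vw0.
have [o0 o1 L] := phiP _ e0Q.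
have vt : valid (prepend e0 t) by rewrite -w0t.
have pf := homeo_invK f (pt (prepend e (flip_first false (zigzag k)))).
rewrite w0E w0t L // in pf.
have := pt_alternating vw (valid_flip false o0 o1 vt) (alternating_zigzag _ _ _) (esym pf).
move/prepend_comparable => pe.
have {pe} : prefix (phi e0) e.
  case: pe => // /prefixP[u pu].
  have := XN _ (map_f phi e0Q); rewrite pu size_cat seN; lia.
case/prefixP=> -[|c u] eu; first by rewrite eu cats0; exact: map_f.
have := nx (phi e0) (c :: u) eu _ _; rewrite map_f //; case=> //.
by rewrite -size_eq0; apply: contraTneq o0 => /size0nil p0; rewrite o1 p0.
Qed.

Lemma T_A_inv f : T_A f -> T_A (f^-1)%g.
Proof.
move=> /T_A_table[Q [Q' [_ /half_table_level L]]].
exact: (@level_T_A (f^-1)%g _ L).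
Qed.

(** * Incidence at the vertices of the base graph *)

(** The value for words that name no edge is arbitrary. *)
Definition vertex_at (e : word) (i : bool) : vertex :=
  if edge_of e is Some E then end_vertex E i else ([::], v_l).

Lemma pt_end_streamE e f i j : colour_of e -> colour_of f ->
  pt (end_stream e i) = pt (end_stream f j) <-> vertex_at e i = vertex_at f j.
Proof.
rewrite !colour_of_some /vertex_at; case eE: (edge_of e) => [E|] // _.
by case fF: (edge_of f) => [F|] // _; exact: pt_end_stream.
Qed.

Lemma carries_end f e e' b i : carries f e e' b ->
  f (pt (end_stream e i)) = pt (end_stream e' ((b && (colour_of e == Some Blue)) (+) i)).
Proof.
move=> [oe ee' H]; rewrite H; last exact: valid_end_stream.
rewrite /end_stream -ee'; case: (colour_of e) oe => [[]|] // _ /=.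
  by rewrite andbF flip_first_red //; exact: valid_tail_end.
by rewrite andbT flip_end_tail.
Qed.

Lemma vertex_at_rcons e c i : vertex_at (rcons e c) i =
  if e is [::] then vertex_at [:: c] i else
  if edge_of e is Some E then
    if child E c is Some F then end_vertex F i else ([::], v_l)
  else ([::], v_l).
Proof.
rewrite /vertex_at; have [->|e0] := eqVneq e [::]; first by [].
by rewrite edge_of_rcons //; case: e e0 => // a v _; case: (edge_of _).
Qed.

(** All edges, of all levels, at the vertices of the base graph. *)
Inductive at_base : vertex_name -> colour -> word -> bool -> Prop :=
| at_b_U n : at_base v_b Red (eU :: nseq n r1) false
| at_a_U n : at_base v_a Red (eU :: nseq n r2) true
| at_a_D n : at_base v_a Red (eD :: nseq n r1) false
| at_b_D n : at_base v_b Red (eD :: nseq n r2) true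
| at_a_L : at_base v_a Blue [:: eL] false
| at_a_Lm n : at_base v_a Blue (eL :: bm :: nseq n bp) true
| at_l n : at_base v_l Blue (eL :: nseq n bp) true
| at_b_R : at_base v_b Blue [:: eR] false
| at_b_Rm n : at_base v_b Blue (eR :: bm :: nseq n bp) true
| at_r n : at_base v_r Blue (eR :: nseq n bp) true.

Lemma rcons_nseq T n (x : T) : rcons (nseq n x) x = nseq n.+1 x.
Proof. by elim: n => //= n ->. Qed.

(** A child keeps at most one vertex of its parent, and each family of edges in
    [at_base] is closed under the child that keeps the vertex. *)
Lemma at_baseP e E i x : edge_of e = Some E -> end_vertex E i = ([::], x) ->
  at_base x (col E) e i.
Proof.
elim/last_ind: e E i => // e c IH E i.
have [->|e0] := eqVneq e [::].
  by case: c => // -[<-]; case: i => -[<-] /=;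
    first [exact: (at_l 0)|exact: at_a_L|exact: (at_r 0)|exact: at_b_R
          |exact: (at_a_U 0)|exact: (at_b_U 0)|exact: (at_b_D 0)|exact: (at_a_D 0)].
rewrite edge_of_rcons //; case eF: (edge_of e) => [F|] //=.
have nF := edge_of_name eF.
case: F eF nF => n k s t eF /= nF; rewrite nF => cF vE.
have IHj j : end_vertex (Edge n k s t) j = ([::], x) -> at_base x k e j.
  by move=> H; exact: (IH _ _ eF H).
have ext k' c' j j' : at_base x k' e j ->
    (k', j, c', j') \in [:: (Red, false, r1, false); (Red, true, r2, true);
      (Blue, false, bm, true); (Blue, true, bp, true)] ->
    at_base x k' (rcons e c') j'.
  case=> [m|m|m|m||m|m||m|m]; rewrite !inE => /or4P[] /eqP[] // *; subst;
    rewrite /= ?rcons_nseq;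
    first [exact: (at_a_Lm 0)|exact: (at_b_Rm 0)|by constructor].
case: k eF IHj cF => eF IHj; case: c => // -[EE]; move: vE; rewrite -EE /=;
  case: i => /= vE; first
  [ by case: vE e0 => -> | by apply: (ext _ _ false); first exact: IHj
  | by apply: (ext _ _ true); first exact: IHj ].
Qed.

Lemma at_base_vertex e i x : colour_of e -> vertex_at e i = ([::], x) ->
  exists k, colour_of e = Some k /\ at_base x k e i.
Proof.
rewrite colour_of_some /vertex_at /colour_of; case eE: (edge_of e) => [E|] // _ H.
by exists (col E); split=> //; exact: at_baseP H.
Qed.

Lemma vertex_at_red e n i : colour_of e = Some Red ->
  vertex_at (e ++ nseq n (if i then r2 else r1)) i = vertex_at e i.
Proof.
move=> er; have e0 := colour_of_nnil er.
elim: n => [|n IH]; first by rewrite cats0.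
have orr : colour_of (e ++ nseq n (if i then r2 else r1)) = Some Red.
  by rewrite (colour_of_cat _ er); case: (i); elim: n {IH}.
rewrite -rcons_nseq -rcons_cat vertex_at_rcons.
case en: (e ++ _) orr IH => [|c v] //; rewrite /colour_of /vertex_at.
case: (edge_of _) => [[m k s t]|] //= [->].
by case: (i) => /= ->.
Qed.

Lemma vertex_at_child e c i : colour_of e = Some Blue ->
  vertex_at (rcons e c) i = match c, i with
    | bm, false | d_, false | u_, true => (e, v_x)
    | bp, false | u_, false | d_, true => (e, v_y)
    | bm, true => vertex_at e false
    | bp, true => vertex_at e true
    | _, _ => ([::], v_l)
    end.
Proof.
move=> eb; rewrite vertex_at_rcons; case: e eb => [|a v] // eb.
move: eb; rewrite /colour_of /vertex_at; case eE: (edge_of _) => [[m k s t]|] //= [->].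
by have := edge_of_name eE => /= <-; case: c; case: i.
Qed.

Lemma red_spine i (t : rtree) :
  exists n, nseq n (if i then r2 else r1) \in rleaves t.
Proof.
elim: t => [|a [n Ha] b [m Hb] s]; first by exists 0.
by case: i Ha Hb => Ha Hb; [exists m.+1|exists n.+1];
  rewrite /= !mem_cat !mem_below ?Ha ?Hb.
Qed.

Lemma blue_spine n t : nseq n.+1 bp \in bleaves t ->
  exists m, nseq n bp ++ u_ :: nseq m r1 \in bleaves t.
Proof.
elim: n t => [|n IH] [|a b u d] //; rewrite [bleaves _]/= !mem_cat !mem_below //=.
  move=> _; have [m um] := red_spine false u.
  by exists m; rewrite !mem_cat !mem_below um.
rewrite orbF => /IH[m um]; exists m.
by rewrite /= !mem_cat !mem_below um.
Qed.

Lemma colour_of_spine e n i : colour_of e = Some Red ->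
  colour_of (e ++ nseq n (if i then r2 else r1)) = Some Red.
Proof. by move=> er; rewrite (colour_of_cat _ er); case: i; elim: n. Qed.

(** A blue leaf below [bm] lies between two circles, so its source is a vertex of
    a circle; the red leaf is found on that circle by following r2 or r1. *)
Lemma inner_leaf_src c t n : colour_of [:: c] = Some Blue ->
  bm :: nseq n bp \in bleaves t ->
  exists v i, [/\ v \in bleaves t, colour_of (c :: v) = Some Red &
    vertex_at (c :: v) i = vertex_at (c :: bm :: nseq n bp) false].
Proof.
move=> cb; case: t => [|a b u d]; first by rewrite inE.
rewrite [bleaves _]/= !mem_cat !mem_below /= orbF => na.
have bcol m : colour_of (c :: bm :: nseq m bp) = Some Blue.
  by rewrite -cat1s (colour_of_cat _ cb); elim: m.
case: n na => [|n] na.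
  have [m um] := red_spine true u; exists (u_ :: nseq m r2), true.
  have ur : colour_of [:: c; u_] = Some Red by rewrite -cat1s (colour_of_cat _ cb).
  rewrite !mem_cat !mem_below um -[c :: u_ :: _]/([:: c; u_] ++ _).
  split=> //; first exact: (colour_of_spine m true ur).
  by rewrite (vertex_at_red m true ur) -[[:: c; u_]]/(rcons [:: c] u_)
    -[[:: c; bm]]/(rcons [:: c] bm) !(vertex_at_child _ _ cb).
have [m um] := blue_spine na; exists (bm :: nseq n bp ++ u_ :: nseq m r1), false.
have ur : colour_of (rcons (c :: bm :: nseq n bp) u_) = Some Red.
  by rewrite colour_of_rcons // bcol.
have E : c :: bm :: nseq n bp ++ u_ :: nseq m r1 =
    rcons (c :: bm :: nseq n bp) u_ ++ nseq m r1 by rewrite cat_rcons.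
rewrite E !mem_cat !mem_below um; split=> //; first exact: (colour_of_spine m false ur).
rewrite (vertex_at_red m false ur) -[c :: bm :: nseq n.+1 bp]/(c :: bm :: nseq n.+1 bp).
by rewrite -rcons_nseq -!rcons_cons !(vertex_at_child _ _ (bcol n)).
Qed.

(** * The action of the generators on tables *)

Section Generators.
Variables al be ga de ep : homeo airplane.
Hypotheses (Hal : is_alpha al) (Hbe : is_beta be) (Hga : is_gamma ga).
Hypotheses (Hde : is_delta de) (Hep : is_epsilon ep).

Lemma map_flip_word0 X : [seq flip_word false v | v <- X] = X.
Proof. by rewrite -[RHS]map_id; apply: eq_map => v; exact: flip_word0. Qed.

Ltac solve_carries := first
  [apply/carries_canonical; assumption | apply: reversed_carries; assumption].

Ltac pieces s := apply: (@table_pieces _ s);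
  [ move=> ? ? ? ?; rewrite !inE;
    repeat (case/orP; [by move/eqP=> [-> -> -> _]; solve_carries |]);
    by move/eqP=> [-> -> -> _]; solve_carries
  | move=> ?; rewrite /leaves /= ?below_cat ?below_below /= ?mem_cat ?in_nil ?orbF;
    do ?[case: (_ \in _) => //=]
  | move=> ?; rewrite /leaves /= ?map_flip_word0 ?below_cat ?below_below /= ?mem_cat
      ?mem_below_flip ?in_nil ?orbF;
    do ?[case: (_ \in _) => //=] ].

Lemma table_alpha x y u d R U D :
  table al (Forest (BN x y u d) R U D) (Forest y (BN (flip_tree x) R U D) d u).
Proof.
have [[A1 A2 A3 A4] [A5 A6 A7]] := Hal.
pieces [:: ([:: eL; bm], [:: eR; bm], true, bleaves x);
           ([:: eL; bp], [:: eL], false, bleaves y);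
           ([:: eL; u_], [:: eD], false, rleaves u);
           ([:: eL; d_], [:: eU], false, rleaves d);
           ([:: eR], [:: eR; bp], false, bleaves R);
           ([:: eU], [:: eR; u_], false, rleaves U);
           ([:: eD], [:: eR; d_], false, rleaves D)].
Qed.

Lemma table_beta L R U D1 D2 Ds :
  table be (Forest L R U (RN D1 D2 Ds)) (Forest Ds R (RN U D1 L) D2).
Proof.
have [[A1 A2 A3] [A4 A5 A6]] := Hbe.
pieces [:: ([:: eL], [:: eU; s_], false, bleaves L);
           ([:: eU], [:: eU; r1], false, rleaves U);
           ([:: eD; r1], [:: eU; r2], false, rleaves D1);
           ([:: eD; r2], [:: eD], false, rleaves D2);
           ([:: eD; s_], [:: eL], false, bleaves Ds);
           ([:: eR], [:: eR], false, bleaves R)].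
Qed.

Lemma table_gamma L R X Y Z s2 s1 D :
  table ga (Forest L R (RN X (RN Y Z s2) s1) D)
           (Forest L R (RN (RN X Y s1) Z s2) D).
Proof.
have [[A1 A2 A3] [A4 A5 A6 A7 A8]] := Hga.
pieces [:: ([:: eL], [:: eL], false, bleaves L);
           ([:: eD], [:: eD], false, rleaves D);
           ([:: eR], [:: eR], false, bleaves R);
           ([:: eU; r1], [:: eU; r1; r1], false, rleaves X);
           ([:: eU; s_], [:: eU; r1; s_], false, bleaves s1);
           ([:: eU; r2; r1], [:: eU; r1; r2], false, rleaves Y);
           ([:: eU; r2; s_], [:: eU; s_], false, bleaves s2);
           ([:: eU; r2; r2], [:: eU; r2], false, rleaves Z)].
Qed.

Lemma table_delta L R U D : table de (Forest L R U D) (Forest R L D U).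
Proof.
have [A1 A2 A3 A4] := Hde.
pieces [:: ([:: eL], [:: eR], false, bleaves L);
           ([:: eR], [:: eL], false, bleaves R);
           ([:: eU], [:: eD], false, rleaves U);
           ([:: eD], [:: eU], false, rleaves D)].
Qed.

Lemma table_epsilon L a b u1 d1 y u d U D :
  table ep (Forest L (BN (BN a b u1 d1) y u d) U D)
           (Forest L (BN b (BN (flip_tree a) y u d) d1 u1) U D).
Proof.
have [[A1 A2 A3] [[A4 A5 A6 A7] [A8 A9 A10]]] := Hep.
pieces [:: ([:: eL], [:: eL], false, bleaves L);
           ([:: eU], [:: eU], false, rleaves U);
           ([:: eD], [:: eD], false, rleaves D);
           ([:: eR; bm; bp], [:: eR; bm], false, bleaves b);
           ([:: eR; bm; d_], [:: eR; u_], false, rleaves d1);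
           ([:: eR; bm; u_], [:: eR; d_], false, rleaves u1);
           ([:: eR; bm; bm], [:: eR; bp; bm], true, bleaves a);
           ([:: eR; u_], [:: eR; bp; u_], false, rleaves u);
           ([:: eR; d_], [:: eR; bp; d_], false, rleaves d);
           ([:: eR; bp], [:: eR; bp; bp], false, bleaves y)].
Qed.
End Generators.

(** * Fixed points and contractions *)

Fixpoint rsize (t : rtree) := if t is RN a b _ then (rsize a + rsize b).+1 else 0.

Fixpoint rblue (t : rtree) : nat :=
  if t is RN a b s then rblue a + rblue b + bblue s else 0
with bblue (t : btree) : nat :=
  if t is BN a b u d then (bblue a + bblue b + rblue u + rblue d).+1 else 0.

Definition blue (Q : forest) :=
  bblue (inL Q) + bblue (inR Q) + rblue (inU Q) + rblue (inD Q).

Lemma bblue_flip t : bblue (flip_tree t) = bblue t.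
Proof. by case: t => //= *; lia. Qed.

Lemma flip_treeK : involutive flip_tree. Proof. by case. Qed.

Lemma bblue0 t : bblue t = 0 -> t = BL. Proof. by case: t. Qed.

(** The lower arc cut into arcs by successive halving of the last one; the
    entries of [ss] are the rays at the cutting points. *)
Definition comb (ss : seq btree) : rtree := foldr (fun s t => RN RL t s) RL ss.

Lemma comb_blue0 ss : rblue (comb ss) = 0 -> comb ss = comb (nseq (size ss) BL).
Proof.
elim: ss => //= s ss IH /eqP; rewrite addn_eq0 => /andP[/eqP/IH-> /eqP/bblue0->].
by [].
Qed.

Definition point_b : airplane := pt (end_stream [:: eR] false).
Definition point_a : airplane := pt (end_stream [:: eL] false).

Lemma ptE e f i j : colour_of e -> colour_of f -> vertex_at e i = vertex_at f j ->
  pt (end_stream e i) = pt (end_stream f j).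
Proof. by move=> oe of_ /(pt_end_streamE _ _ oe of_). Qed.

Lemma point_bE e i : colour_of e -> vertex_at e i = ([::], v_b) -> point_b = pt (end_stream e i).
Proof. by move=> oe v; apply: ptE. Qed.

Lemma point_aE e i : colour_of e -> vertex_at e i = ([::], v_a) -> point_a = pt (end_stream e i).
Proof. by move=> oe v; apply: ptE. Qed.

Lemma nil_bleaves t : [::] \in bleaves t -> t = BL.
Proof. by case: t => //= a b u d; rewrite !mem_cat !nil_below. Qed.

Lemma at_b_blue e j : at_base v_b Blue e j ->
  (e = [:: eR] /\ j = false) \/ exists n, e = eR :: bm :: nseq n bp /\ j = true.
Proof. by move=> ab; inversion ab; subst; [left|right; exists n]. Qed.

Lemma at_a_blue e j : at_base v_a Blue e j ->
  (e = [:: eL] /\ j = false) \/ exists n, e = eL :: bm :: nseq n bp /\ j = true.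
Proof. by move=> ab; inversion ab; subst; [left|right; exists n]. Qed.

Lemma at_b_red e : at_base v_b Red e false -> exists n, e = eU :: nseq n r1.
Proof. by move=> ab; inversion ab; exists n. Qed.

Lemma at_a_red e : at_base v_a Red e false -> exists n, e = eD :: nseq n r1.
Proof. by move=> ab; inversion ab; exists n. Qed.

Lemma image_at f Q Q' e i x c j : table f Q Q' -> e \in leaves Q ->
  f (pt (end_stream e i)) = pt (end_stream c j) -> colour_of c -> vertex_at c j = ([::], x) ->
  exists e' b k, [/\ e' \in leaves Q', carries f e e' b, colour_of e = Some k &
    at_base x k e' ((b && (k == Blue)) (+) i)].
Proof.
move=> [fQ _] eQ fe oc vc; have [e' e'Q [b ee']] := fQ _ eQ.
case ek: (colour_of e) (leaves_colour eQ) => [k|] // _.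
have := carries_end i ee'; rewrite ek fe => /pt_end_streamE-/(_ oc (leaves_colour e'Q)).
rewrite vc => /esym /(at_base_vertex (leaves_colour e'Q))[k'].
rewrite -(carries_col ee') ek => -[[<-]] ab.
by exists e', b, k.
Qed.

(** The target of [c] is a leaf of the limit space, the end of no red edge,
    whereas every end of a leaf below [bm] is the end of a red edge. *)
Lemma not_reversed f Q Q' c n : table f Q Q' -> c = eL \/ c = eR ->
  c :: bm :: nseq n bp \in leaves Q' -> ~ carries f [:: c] (c :: bm :: nseq n bp) true.
Proof.
move=> [_ fQ] cLR lQ' Hf.
have cb : colour_of [:: c] = Some Blue by case: cLR => ->.
have [t tn tQ] : exists2 t, bm :: nseq n bp \in bleaves t &
    {subset below [:: c] (bleaves t) <= leaves Q'}.
  case: cLR lQ' => -> ; rewrite /leaves !mem_cat !mem_below /= orbF => lQ'.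
    by exists (inL Q') => // w; rewrite !mem_cat => ->.
  by exists (inR Q') => // w; rewrite !mem_cat => ->; rewrite orbT.
have [v [i [vt vr vE]]] := inner_leaf_src cb tn.
have [|e0 _ [b0 H]] := fQ (c :: v); first by apply: tQ; rewrite mem_below eqxx.
have := carries_end i H; rewrite vr andbF /=.
have [oc _ _] := Hf; have oe0 : colour_of e0 by rewrite -(carries_col H) vr.
have -> : pt (end_stream (c :: v) i) = f (pt (end_stream [:: c] true)).
  rewrite (carries_end _ Hf) cb /=; apply: ptE vE; first by rewrite vr.
  exact: leaves_colour lQ'.
rewrite homeo_funK => /(pt_end_streamE _ _ oc oe0) /esym vE0.
have [x [xE xlr]] : exists x, vertex_at [:: c] true = ([::], x) /\ (x = v_l \/ x = v_r).
  by case: cLR => ->; eexists; (split; first by []); [left|right].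
have [k [ek ab]] := at_base_vertex oe0 (etrans vE0 xE).
move: ek; rewrite -(carries_col H) vr => -[kE]; subst k.
by case: xlr => xE'; subst x; inversion ab.
Qed.

(** The expansion [Q2] is obtained from [Q1] by undoing the expansion of [c]. *)
Definition contracts (c : symbol) (Q1 Q2 : forest) :=
  [/\ [:: c] \in leaves Q2, [:: c] \notin leaves Q1 &
   forall e, e <> [:: c] ->
     (e \in leaves Q2) = (e \in leaves Q1) && (ohead e != Some c)].

Lemma carries_parent f e : colour_of e ->
  (forall c, colour_of (rcons e c) -> carries f (rcons e c) (rcons e c) false) ->
  carries f e e false.
Proof.
move=> oe H; split=> // t vt; rewrite flip_first0 prepend_head.
case ek: (colour_of e) oe => [k|] // _.
have oc : colour_of (rcons e (t 0)).
  by rewrite colour_of_rcons ?(colour_of_nnil ek) // ek; have := (valid_prepend _ ek).1 vt 1.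
by have [_ _ ->] := H _ oc; rewrite // -prepend_head.
Qed.

(** An edge of [Q1] outside [c] is not carried below [c], where [f] is the
    identity: the two cells would have the same image. *)
Lemma half_table_contract (f : homeo airplane) c Q1 Q1' Q2 Q2' : colour_of [:: c] ->
  (forall c', colour_of [:: c; c'] -> carries f [:: c; c'] [:: c; c'] false) ->
  contracts c Q1 Q2 -> contracts c Q1' Q2' -> half_table f Q1 Q1' -> half_table f Q2 Q2'.
Proof.
move=> oc fc [_ _ Q2E] [c2 c1 Q2E'] fQ e; have [->|/eqP ec] := eqVneq e [:: c].
  by exists [:: c] => //; exists false; exact: carries_parent.
rewrite Q2E // => /andP[eQ he]; have [e' e'Q [b ee']] := fQ _ eQ.
exists e'; last by exists b.
have ec' : e' <> [:: c] by move=> E; move: e'Q; rewrite E (negPf c1).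
rewrite Q2E' // e'Q /=; apply/negP => /eqP he'.
have oe' := leaves_colour e'Q.
case: e' e'Q ee' ec' he' oe' => [|a [|c' v]] // e'Q ee' ec' [ac] oe'; subst a.
  by case: ec'.
have L : carries f ([:: c; c'] ++ v) ([:: c; c'] ++ v) false.
  exact: carries_ext0 (fc _ (@colour_of_prefix [:: c; c'] v isT oe')) oe'.
have oe := leaves_colour eQ.
by case: (carries_comparable ee' L) => /prefixP[w];
  case: (e) oe he => // a u _ /= /eqP ac /(congr1 ohead) /= aE; congruence.
Qed.

Lemma table_contract (f : homeo airplane) c Q1 Q1' Q2 Q2' : colour_of [:: c] ->
  (forall c', colour_of [:: c; c'] -> carries f [:: c; c'] [:: c; c'] false) ->
  contracts c Q1 Q2 -> contracts c Q1' Q2' -> table f Q1 Q1' -> table f Q2 Q2'.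
Proof.
move=> oc fc C C' [fQ fQ']; split; first exact: half_table_contract C C' fQ.
apply: (@half_table_contract (f^-1)%g) C' C fQ' => // c' oc'.
exact: carries_inv (homeo_funK f) (fc _ oc').
Qed.

Lemma contract_U L R D : contracts eU (Forest L R (RN RL RL BL) D) (Forest L R RL D).
Proof.
split; try by rewrite /leaves !mem_cat !mem_below.
case=> [|c v] vU; rewrite !mem_cat; first by rewrite !nil_below.
rewrite !mem_below; case: c vU; case: v => [|c v] vU /=;
  by rewrite ?andbF ?orbF ?andbT //; case: vU.
Qed.

Lemma contract_L R U D :
  contracts eL (Forest (BN BL BL RL RL) R U D) (Forest BL R U D).
Proof.
split; try by rewrite /leaves !mem_cat !mem_below.
case=> [|c v] vU; rewrite !mem_cat; first by rewrite !nil_below.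
rewrite !mem_below; case: c vU; case: v => [|c v] vU /=;
  by rewrite ?andbF ?orbF ?andbT //; case: vU.
Qed.

(** * The five elements generate all rearrangements *)

Section Generation.
Variables al be ga de ep : homeo airplane.
Hypotheses (Hal : is_alpha al) (Hbe : is_beta be) (Hga : is_gamma ga).
Hypotheses (Hde : is_delta de) (Hep : is_epsilon ep).
Variable G : set (homeo airplane).
Hypothesis subG : subgroup G.
Hypotheses (Gal : G al) (Gbe : G be) (Gga : G ga) (Gde : G de) (Gep : G ep).

Lemma G1 : G 1%g. Proof. by case: subG. Qed.
Lemma GM f g : G f -> G g -> G (f * g)%g. Proof. by case: subG => _ + _; exact. Qed.
Lemma GV f : G f -> G (f^-1)%g. Proof. by case: subG => _ _; exact. Qed.

Lemma GKl f g : G g -> G (g * f)%g -> G f.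
Proof. by move=> Gg /(GM (GV Gg)); rewrite mulKg. Qed.

Lemma GKr f g : G g -> G (f * g)%g -> G f.
Proof. by move=> Gg /GM /(_ (GV Gg)); rewrite mulgK. Qed.

Definition joined (K : set (homeo airplane)) Q Q' := exists2 g, K g & table g Q Q'.

Lemma joined_trans (K : set (homeo airplane)) Q Q' Q'' : subgroup K ->
  joined K Q Q' -> joined K Q' Q'' -> joined K Q Q''.
Proof.
move=> [_ KM _] [g Kg gQ] [h Kh hQ].
by exists (h * g)%g; [exact: KM | exact: table_comp hQ].
Qed.

Lemma joined_refl (K : set (homeo airplane)) Q : subgroup K -> joined K Q Q.
Proof. by case=> K1 _ _; exists 1%g => //; exact: table1. Qed.

Lemma joined_sym (K : set (homeo airplane)) Q Q' : subgroup K ->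
  joined K Q Q' -> joined K Q' Q.
Proof. by case=> _ _ KV [g Kg gQ]; exists (g^-1)%g; [exact: KV|exact: table_inv]. Qed.

(** Used where the range must be rearranged while [f b = b] is preserved. *)
Definition G_fix_b : set (homeo airplane) := [set g | G g /\ g point_b = point_b].

Lemma G_fix_b_subgroup : subgroup G_fix_b.
Proof.
split=> [|f g [Gf fb] [Gg gb]|f [Gf fb]]; first by split=> //; exact: G1.
  by split; [exact: GM | rewrite /= gb fb].
by split; [exact: GV | rewrite -{1}fb; exact: homeo_funK].
Qed.

Lemma carries_fix (f : airplane -> airplane) e i :
  carries f e e false -> f (pt (end_stream e i)) = pt (end_stream e i).
Proof. by move=> /(carries_end i) ->. Qed.

Lemma beta_fix_b : G_fix_b be.
Proof.
have [_ [_ _ H]] := Hbe; split=> //.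
by apply: carries_fix; apply/carries_canonical.
Qed.

Lemma gamma_fix_b : G_fix_b ga.
Proof.
have [[_ _ H] _] := Hga; split=> //.
by apply: carries_fix; apply/carries_canonical.
Qed.

Lemma joined_beta L R U D1 D2 Ds :
  joined G_fix_b (Forest L R U (RN D1 D2 Ds)) (Forest Ds R (RN U D1 L) D2).
Proof. by exists be; [exact: beta_fix_b | exact: table_beta]. Qed.

Lemma joined_gamma L R X Y Z s2 s1 D :
  joined G_fix_b (Forest L R (RN X (RN Y Z s2) s1) D)
          (Forest L R (RN (RN X Y s1) Z s2) D).
Proof. by exists ga; [exact: gamma_fix_b | exact: table_gamma]. Qed.

Lemma joined_G Q Q' : joined G_fix_b Q Q' -> joined G Q Q'.
Proof. by case=> g [Gg _]; exists g. Qed.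

(** Each [beta] moves the first half of the lower arc to the upper one. *)
Lemma clear_D L R U D : exists L' U',
  joined G_fix_b (Forest L R U D) (Forest L' R U' RL) /\
  bblue L' + rblue U' = bblue L + rblue U + rblue D.
Proof.
elim: D L U => [|D1 _ D2 IH Ds] L U.
  by exists L, U; split; [exact: joined_refl G_fix_b_subgroup | rewrite /=; lia].
have [L' [U' [m E]]] := IH Ds (RN U D1 L).
exists L', U'; split; first exact: joined_trans G_fix_b_subgroup (joined_beta _ _ _ _ _ _) m.
by rewrite E /=; lia.
Qed.

(** Lexicographic induction: [gamma] shortens the right spine of the upper arc,
    and once the second half is a single edge, the inverse of [beta] moves it to
    the comb. *)
Lemma clear_U n L R U ss : rsize U <= n -> exists L' ss',
  joined G_fix_b (Forest L R U (comb ss)) (Forest L' R RL (comb ss')) /\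
  bblue L' + rblue (comb ss') = bblue L + rblue U + rblue (comb ss).
Proof.
elim: n L U ss => [|n IH] L [|X Y s] ss //.
- by exists L, ss; split; [exact: joined_refl G_fix_b_subgroup | rewrite /=; lia].
- by exists L, ss; split; [exact: joined_refl G_fix_b_subgroup | rewrite /=; lia].
elim: Y X s => [|Y1 _ Z IHZ s2] X s Xn.
  have [|L' [ss' [m E]]] := IH s X (L :: ss); first by move: Xn => /=; lia.
  exists L', ss'; split; last by rewrite E /=; lia.
  apply: joined_trans G_fix_b_subgroup _ m; apply: joined_sym G_fix_b_subgroup _; exact: joined_beta.
have [|L' [ss' [m E]]] := IHZ (RN X Y1 s) s2; first by move: Xn => /=; lia.
exists L', ss'; split; last by rewrite E /=; lia.
exact: joined_trans G_fix_b_subgroup (joined_gamma _ _ _ _ _ _ _ _) m.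
Qed.

Lemma to_comb L R U D : exists L' ss,
  joined G_fix_b (Forest L R U D) (Forest L' R RL (comb ss)) /\
  bblue L' + rblue (comb ss) = bblue L + rblue U + rblue D.
Proof.
have [L1 [U1 [m1 E1]]] := clear_D L R U D.
have [L2 [ss [m2 E2]]] := clear_U L1 R [::] (leqnn (rsize U1)).
exists L2, ss; split; first exact: joined_trans G_fix_b_subgroup m1 m2.
by rewrite E2 -E1 /=; lia.
Qed.

(** [beta] runs through the rays of the comb, bringing each of them to [eL]. *)
Lemma blue_to_L L R U ss : 0 < bblue L + rblue (comb ss) ->
  exists a b u d U' D', joined G (Forest L R U (comb ss)) (Forest (BN a b u d) R U' D') /\
  bblue (BN a b u d) + rblue U' + rblue D' = bblue L + rblue U + rblue (comb ss).
Proof.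
elim: ss L U => [|s ss IH] [|a b u d] U // n0; try by
  exists a, b, u, d, U; eexists; split; first exact: joined_refl subG.
have [|a [b [u [d [U' [D' [m E]]]]]]] := IH s (RN U RL BL).
  by move: n0; rewrite /=; lia.
exists a, b, u, d, U', D'; split; last by rewrite E /=; lia.
exact: joined_trans subG (joined_G (joined_beta _ _ _ _ _ _)) m.
Qed.

(** When the left ray is expanded, [alpha] makes its circle central and puts the
    old central circle behind [eR]; fewer circles remain outside [eR]. *)
Lemma blue_to_R n L R U D : bblue L + rblue U + rblue D <= n -> exists R' k,
  joined G (Forest L R U D) (Forest BL R' RL (comb (nseq k BL))) /\
  bblue R' = bblue L + bblue R + rblue U + rblue D.
Proof.
elim: n L R U D => [|n IH] L R U D n0.
all: have [L1 [ss [/joined_G m1 E1]]] := to_comb L R U D.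
all: have [Z|] := posnP (bblue L1 + rblue (comb ss)).
- exists R, (size ss); move/eqP: Z; rewrite addn_eq0 => /andP[/eqP l0 /eqP c0].
  by rewrite (bblue0 l0) (comb_blue0 c0) in m1; split=> //; lia.
- by lia.
- exists R, (size ss); move/eqP: Z; rewrite addn_eq0 => /andP[/eqP l0 /eqP c0].
  by rewrite (bblue0 l0) (comb_blue0 c0) in m1; split=> //; lia.
move/(@blue_to_L L1 R RL) => [x [y [u [d [U' [D' [m2 E2]]]]]]].
have [|R' [k [m3 E3]]] := IH y (BN (flip_tree x) R U' D') d u.
  by move: E2; rewrite /= => E2; lia.
exists R', k; split; last by move: E2 E3; rewrite /= bblue_flip => E2 ->; lia.
apply: joined_trans subG m1 _; apply: joined_trans subG m2 _.
by apply: joined_trans subG _ m3; exists al; [|exact: table_alpha].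
Qed.

Definition reach (s : word) (Q : forest) :=
  exists2 g, G g & (exists Q', table g Q Q') /\ g (pt (end_stream s false)) = point_b.

Lemma reach_step g Q Q' e e' b v : G g -> table g Q Q' -> carries g e e' b ->
  colour_of (e ++ v) = Some Red ->
  (colour_of (e' ++ flip_word b v) = Some Red -> reach (e' ++ flip_word b v) Q') ->
  reach (e ++ v) Q.
Proof.
move=> Gg gQ ee' ev; have L := carries_ext ee' (_ : colour_of (e ++ v)).
rewrite ev in L; case; first by rewrite -(carries_col (L isT)).
move=> h Gh [[Q'' hQ] hb].
exists (h * g)%g; first exact: GM.
split; first by exists Q''; exact: table_comp hQ.
by rewrite /= (carries_end _ (carries_red ev (L isT))) ev andbF.
Qed.

Lemma reach_step0 g Q Q' e e' v : G g -> table g Q Q' -> carries g e e' false ->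
  colour_of (e ++ v) = Some Red -> (colour_of (e' ++ v) = Some Red -> reach (e' ++ v) Q') ->
  reach (e ++ v) Q.
Proof. by move=> Gg gQ ee' ev r; apply: reach_step Gg gQ ee' ev _; rewrite flip_word0. Qed.

Lemma table_alphaV L x y u d U D :
  table (al^-1)%g (Forest L (BN x y u d) U D) (Forest (BN (flip_tree x) L D U) y u d).
Proof.
by apply: table_inv; rewrite -{2}(flip_treeK x); exact: table_alpha.
Qed.

Lemma table_betaV L R X Y s D :
  table (be^-1)%g (Forest L R (RN X Y s) D) (Forest s R X (RN Y D L)).
Proof. by apply: table_inv; exact: table_beta. Qed.

Lemma carriesV (f : homeo airplane) e e' : canonical_on f e e' -> carries (f^-1)%g e' e false.
Proof. by move/carries_canonical; exact: carries_inv (homeo_funK f). Qed.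

Lemma reach_b Q s : colour_of s -> vertex_at s false = ([::], v_b) -> reach s Q.
Proof.
move=> os sb; exists 1%g; first exact: G1.
by split; [exists Q; exact: table1 | rewrite -(point_bE os sb)].
Qed.

Lemma size_flip_word b v : size (flip_word b v) = size v. Proof. by case: v. Qed.

(** The central circle is approached by moving the root outwards with the inverse
    of [alpha] and, when the edge lies on the near side [eR bm] of the circle of
    [eR], by pulling it nearer with [epsilon].  Each round shortens the word, up to
    half turns by [delta], which the second summand of the measure counts. *)
Lemma reach_red n s Q : (size s).*2 + (head eU s \in [:: eL; eD]) <= n ->
  s \in leaves Q -> colour_of s = Some Red -> reach s Q.
Proof.
have [[A1 A2 A3 A4] [A5 A6 A7]] := Hal.
have [[B1 B2 B3] [B4 B5 B6]] := Hbe.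
have [[C1 C2 C3] [C4 C5 C6 C7 C8]] := Hga.
have [D1 D2 D3 D4] := Hde.
have [[E1 E2 E3] [[E4 E5 E6 E7] [E8 E9 E10]]] := Hep.
have GaV := GV Gal; have GbV := GV Gbe.
elim: n s Q => [|n IH] [|c v] [L R U D] //.
move=> sn; rewrite /leaves !mem_cat !mem_below [inL _]/= [inR _]/= [inU _]/= [inD _]/=.
have small s Q : size s <= size v -> s \in leaves Q -> colour_of s = Some Red -> reach s Q.
  move=> sv; apply: IH; apply: leq_trans (leq_add (leqnn _) (leq_b1 _)) _.
  rewrite addn1 -ltnS; apply: leq_trans (leq_trans (leq_addr _ _) sn).
  by rewrite doubleS !ltnS leq_double.
case/or4P=> /andP[/eqP c0 vt] ocv; subst c.
- apply: (@reach_step0 de _ _ [:: eL] [:: eR] v) ocv _ => //.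
  + exact: table_delta.
  + exact/carries_canonical.
  apply: IH; first by move: sn; rewrite /=; lia.
  by rewrite /leaves !mem_cat !mem_below /= vt ?orbT.
- case: R vt => [|x y u d]; first by rewrite inE => /eqP v0; move: ocv; rewrite v0.
  case: v sn small ocv => [|c v] sn small ocv; first by rewrite !mem_cat !nil_below.
  rewrite [bleaves _]/= !mem_cat !mem_below => /or4P[] /andP[/eqP c0 vt]; subst c.
  + case: x vt => [|a b u1 d1].
      by rewrite inE => /eqP v0; move: ocv; rewrite v0.
    case: v sn small ocv => [|c v] sn small ocv; first by rewrite !mem_cat !nil_below.
    rewrite [bleaves _]/= !mem_cat !mem_below => /or4P[] /andP[/eqP c0 vt]; subst c.
    * apply: (@reach_step ep _ _ [:: eR; bm; bm] [:: eR; bp; bm] true v) ocv _ => //.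
      - exact: table_epsilon.
      - exact: reversed_carries.
      rewrite -[_ ++ flip_word _ _]/([:: eR; bp] ++ (bm :: flip_word true v)) => ocv.
      apply: (@reach_step0 (al^-1)%g _ _ [:: eR; bp] [:: eR]) ocv _ => //.
      - exact: table_alphaV.
      - exact: carriesV.
      apply: small; first by rewrite /= size_flip_word.
      rewrite /leaves /= !(mem_cat, mem_below) /=.
      by rewrite bleaves_flip map_f ?orbT.
    * apply: (@reach_step0 ep _ _ [:: eR; bm; bp] [:: eR; bm] v) ocv _ => //.
      - exact: table_epsilon.
      - exact/carries_canonical.
      by apply: small => //; rewrite /leaves /= !(mem_cat, mem_below) /= vt ?orbT.
    * apply: (@reach_step0 ep _ _ [:: eR; bm; u_] [:: eR; d_] v) ocv _ => //.
      - exact: table_epsilon.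
      - exact/carries_canonical.
      by apply: small => //; rewrite /leaves /= !(mem_cat, mem_below) /= vt ?orbT.
    * apply: (@reach_step0 ep _ _ [:: eR; bm; d_] [:: eR; u_] v) ocv _ => //.
      - exact: table_epsilon.
      - exact/carries_canonical.
      by apply: small => //; rewrite /leaves /= !(mem_cat, mem_below) /= vt ?orbT.
  + apply: (@reach_step0 (al^-1)%g _ _ [:: eR; bp] [:: eR] v) ocv _ => //.
    * exact: table_alphaV.
    * exact: carriesV.
    by apply: small => //; rewrite /leaves /= !(mem_cat, mem_below) /= vt ?orbT.
  + apply: (@reach_step0 (al^-1)%g _ _ [:: eR; u_] [:: eU] v) ocv _ => //.
    * exact: table_alphaV.
    * exact: carriesV.
    by apply: small => //; rewrite /leaves /= !(mem_cat, mem_below) /= vt ?orbT.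
  + apply: (@reach_step0 (al^-1)%g _ _ [:: eR; d_] [:: eD] v) ocv _ => //.
    * exact: table_alphaV.
    * exact: carriesV.
    by apply: small => //; rewrite /leaves /= !(mem_cat, mem_below) /= vt ?orbT.
- case: U vt => [|X Y s]; first by rewrite inE => /eqP v0; subst v; exact: reach_b.
  case: v sn small ocv => [|c v] sn small ocv; first by rewrite !mem_cat !nil_below.
  rewrite [rleaves _]/= !mem_cat !mem_below => /or3P[] /andP[/eqP c0 vt]; subst c.
  + apply: (@reach_step0 (be^-1)%g _ _ [:: eU; r1] [:: eU] v) ocv _ => //.
    * exact: table_betaV.
    * exact: carriesV.
    by apply: small => //; rewrite /leaves /= !(mem_cat, mem_below) /= vt ?orbT.
  + case: Y vt => [|Y Z s2].
      rewrite inE => /eqP v0; subst v.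
      apply: (@reach_step0 (be^-1)%g _ _ [:: eU; r2] [:: eD; r1] [::]) ocv _ => //.
      * exact: table_betaV.
      * exact: carriesV.
      move=> ocv; apply: (@reach_step0 de _ _ [:: eD] [:: eU] [:: r1]) ocv _ => //.
      * exact: table_delta.
      * exact/carries_canonical.
      by move=> _; apply: reach_b.
    case: v sn small ocv => [|c v] sn small ocv; first by rewrite !mem_cat !nil_below.
    rewrite [rleaves _]/= !mem_cat !mem_below => /or3P[] /andP[/eqP c0 vt]; subst c.
    * apply: (@reach_step0 ga _ _ [:: eU; r2; r1] [:: eU; r1; r2] v) ocv _ => //.
      - exact: table_gamma.
      - exact/carries_canonical.
      move=> ocv; apply: (@reach_step0 (be^-1)%g _ _ [:: eU; r1] [:: eU] (r2 :: v)) ocv _ => //.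
      - exact: table_betaV.
      - exact: carriesV.
      by apply: small => //; rewrite /leaves /= !(mem_cat, mem_below) /= vt ?orbT.
    * apply: (@reach_step0 ga _ _ [:: eU; r2; r2] [:: eU; r2] v) ocv _ => //.
      - exact: table_gamma.
      - exact/carries_canonical.
      by apply: small => //; rewrite /leaves /= !(mem_cat, mem_below) /= vt ?orbT.
    * apply: (@reach_step0 ga _ _ [:: eU; r2; s_] [:: eU; s_] v) ocv _ => //.
      - exact: table_gamma.
      - exact/carries_canonical.
      by apply: small => //; rewrite /leaves /= !(mem_cat, mem_below) /= vt ?orbT.
  + apply: (@reach_step0 (be^-1)%g _ _ [:: eU; s_] [:: eL] v) ocv _ => //.
    * exact: table_betaV.
    * exact: carriesV.
    by apply: small => //; rewrite /leaves /= !(mem_cat, mem_below) /= vt ?orbT.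
- apply: (@reach_step0 de _ _ [:: eD] [:: eU] v) ocv _ => //.
  + exact: table_delta.
  + exact/carries_canonical.
  apply: IH; first by move: sn; rewrite /=; lia.
  by rewrite /leaves !mem_cat !mem_below /= vt ?orbT.
Qed.

Definition fixLUD (f : airplane -> airplane) :=
  [/\ carries f [:: eL] [:: eL] false, carries f [:: eU] [:: eU] false &
      carries f [:: eD] [:: eD] false].

Definition G_fix_LUD : set (homeo airplane) := [set g | G g /\ fixLUD g].

Lemma G_fix_LUD_subgroup : subgroup G_fix_LUD.
Proof.
split=> [|f g [Gf [f1 f2 f3]] [Gg [g1 g2 g3]]|f [Gf [f1 f2 f3]]].
- by split; [exact: G1 | split; exact: carries_id].
- split; [exact: GM|split; [exact: (carries_comp g1 f1)|exact: (carries_comp g2 f2)|exact: (carries_comp g3 f3)]].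
- by split; [exact: GV|split; exact: carries_inv (homeo_funK f) _].
Qed.

(** Repeated use of [epsilon] brings the circle nearest to [b] in the cell of [eR]
    to the place of the circle of [eR]. *)
Lemma clear_bm x L y u d U D : exists y' u' d',
  joined G_fix_LUD (Forest L (BN x y u d) U D) (Forest L (BN BL y' u' d') U D) /\
  bblue (BN BL y' u' d') = bblue (BN x y u d).
Proof.
elim: x y u d => [|a _ b IH u1 d1] y u d.
  by exists y, u, d; split=> //; exact: joined_refl G_fix_LUD_subgroup.
have [y' [u' [d' [m E]]]] := IH (BN (flip_tree a) y u d) d1 u1.
exists y', u', d'; split; last by rewrite E /= bblue_flip; lia.
apply: joined_trans G_fix_LUD_subgroup _ m; exists ep; last exact: table_epsilon.
have [[E1 E2 E3] _] := Hep.
by split=> //; split; apply/carries_canonical.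
Qed.

Definition base_forest R := Forest BL R RL RL.

Section Step.
Variable n : nat.
Hypothesis IHn : forall f Q Q', table f Q Q' -> blue Q < n -> G f.

(** After [epsilon] has acted on both sides, [eR bm] is an edge joining the
    central circle to the circle of [eR].  Conjugation by [alpha] turns this edge
    and the central circle with its remaining ray into the four children of [eL],
    on which the conjugate is the identity. *)
Lemma base_case (f : homeo airplane) R R' : bblue R <= n ->
  table f (base_forest R) (base_forest R') -> fixLUD f -> G f.
Proof.
move=> Rn fR fix_f.
have fb (h : homeo airplane) : fixLUD h -> h point_b = point_b.
  by case=> _ hU _; rewrite (@point_bE [:: eU] false) //; exact: carries_fix.
case: R Rn fR => [_|x y u d Rn fR].
  move=> fR; have [|||e' [b [k [e'Q ee' [kE] ab]]]] :=
    @image_at f _ _ [:: eR] false v_b [:: eR] false fR _ (fb _ fix_f) _ _ => //.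
  subst k; move: ab; rewrite andbT addbF.
  case/at_b_blue=> [[? ?]|[m [? ?]]]; subst e' b; last first.
    by case: (not_reversed fR (or_intror erefl) e'Q).
  have [fL fU fD] := fix_f; suff -> : f = 1%g by exact: G1.
  apply: (@homeo_ext _ _ (leaves (base_forest BL))) => [w|e].
    exact: leaves_cover.
  by rewrite !inE => /or4P[] /eqP->; eexists; exists false; split; try eassumption;
      exact: carries_id.
have [y1 [u1 [d1 [[g [Gg fg] gR] E1]]]] := clear_bm x BL y u d RL RL.
have [R2 [h [Gh fh] [hR R2E]]] : exists R2, exists2 h, G_fix_LUD h &
    table h (base_forest R') (base_forest R2) /\
    (R2 = BL \/ exists y u d, R2 = BN BL y u d).
  case: R' fR => [|x' y' u' d'] _.
    by exists BL, 1%g; [case: G_fix_LUD_subgroup|split; [exact: table1|left]].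
  have [y2 [u2 [d2 [[h Gh hR] _]]]] := clear_bm x' BL y' u' d' RL RL.
  by exists (BN BL y2 u2 d2), h => //; split=> //; right; exists y2, u2, d2.
pose f1 := (h * f * g^-1)%g.
suff Gf1 : G f1.
  by apply: GKl Gh _; apply: (GKr (GV Gg)); exact: Gf1.
have fix1 : fixLUD f1.
  have [_ KM KV] := G_fix_LUD_subgroup.
  have [a1 a2 a3] := fix_f; have [b1 b2 b3] := fh; have [c1 c2 c3] := fg.
  by split; [apply: carries_comp (carries_inv (homeo_funK g) c1) (carries_comp a1 b1)
    |apply: carries_comp (carries_inv (homeo_funK g) c2) (carries_comp a2 b2)
    |apply: carries_comp (carries_inv (homeo_funK g) c3) (carries_comp a3 b3)].
have f1R : table f1 (base_forest (BN BL y1 u1 d1)) (base_forest R2).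
  by apply: table_comp (table_inv gR) _; apply: table_comp fR hR.
have Rbm : [:: eR; bm] \in leaves (base_forest (BN BL y1 u1 d1)).
  by rewrite /leaves !(mem_cat, mem_below).
have f1b : f1 (pt (end_stream [:: eR; bm] true)) = pt (end_stream [:: eR] false).
  by rewrite -(@point_bE [:: eR; bm] true) //; exact: fb.
have [e' [b [k [e'Q ee' [kE] ab]]]] := image_at (x := v_b) f1R Rbm f1b isT erefl.
subst k; move: ab; rewrite andbT addbT.
case/at_b_blue=> [[? nb]|[m [? nb]]]; case: b nb ee' => // _ ee'; subst e'.
  case: (@not_reversed _ _ _ eR 0 (table_inv f1R) (or_intror erefl) Rbm).
  exact: carries_inv (homeo_funK f1) ee'.
case: R2E => [R2E|[y2 [u2 [d2 R2E]]]]; subst R2.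
  by move: e'Q; rewrite /leaves !(mem_cat, mem_below) /= ?inE.
have m0 : m = 0.
  by move: e'Q; case: (m) => // m'; rewrite /leaves !(mem_cat, mem_below) /= ?inE.
subst m; pose f2 := (al^-1 * f1 * al)%g.
suff Gf2 : G f2 by apply: GKl (GV Gal) _; exact: GKr Gal Gf2.
have [[A1 A2 A3 A4] [A5 A6 A7]] := Hal.
have [fL fU fD] := fix1.
have conj e a b : carries al e a b -> carries f1 a a false -> carries f2 e e false.
  move=> ea aa; have := carries_comp (carries_comp ea aa) (carries_inv (homeo_funK al) ea).
  by rewrite addFb addbb.
have f2R : table f2 (Forest (BN BL BL RL RL) y1 u1 d1) (Forest (BN BL BL RL RL) y2 u2 d2).
  apply: table_comp (table_alpha Hal _ _ _ _ _ _ _) _.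
  by apply: table_comp f1R _; exact: table_alphaV.
apply: (IHn (table_contract _ _ (contract_L _ _ _) (contract_L _ _ _) f2R)) => //.
  case=> // _.
  + by apply: conj ee'; exact: reversed_carries.
  + by apply: conj fL; apply/carries_canonical.
  + by apply: conj fD; apply/carries_canonical.
  + by apply: conj fU; apply/carries_canonical.
by move: Rn; rewrite -E1 /blue /=; lia.
Qed.

(** Since [f] fixes [b] it fixes [eU], hence [a], hence the left ray and the first
    edge of the lower arc.  Conjugation by [beta] turns these three into the
    children of [eU], which are contracted; the comb becomes shorter. *)
Lemma comb_case k (f : homeo airplane) R L' R' ss : bblue R <= n ->
  table f (Forest BL R RL (comb (nseq k BL))) (Forest L' R' RL (comb ss)) ->
  f point_b = point_b -> G f.
Proof.
move=> Rn; elim: k f L' ss => [|k IH] f L' ss fQ fb.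
all: have UQ D : [:: eU] \in leaves (Forest BL R RL D)
  by rewrite !mem_cat !mem_below !orbT.
all: have LQ D : [:: eL] \in leaves (Forest BL R RL D)
  by rewrite !mem_cat !mem_below.
all: have fU : carries f [:: eU] [:: eU] false.
1, 3: have fUb : f (pt (end_stream [:: eU] false)) = pt (end_stream [:: eR] false)
  by rewrite -(@point_bE [:: eU] false).
1, 2: have [e' [b [k' [e'Q ee' [kE] ab]]]] :=
  image_at (x := v_b) fQ (UQ _) fUb isT erefl.
1, 2: subst k'; move: ab; rewrite andbF => /at_b_red[m em]; subst e';
  move: e'Q; rewrite !mem_cat !mem_below /= inE orbF => /eqP m0;
  by move: ee'; rewrite m0 => /carries_red; apply.
all: have fa : f point_a = point_a by rewrite (@point_aE [:: eU] true) //; exact: carries_fix.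
all: have fL : carries f [:: eL] [:: eL] false /\ L' = BL.
1, 3: have [e' [b [k' [e'Q ee' [kE] ab]]]] :=
  image_at (x := v_a) fQ (LQ _) fa isT erefl.
1, 2: subst k'; move: ab; rewrite andbT addbF;
  case/at_a_blue=> [[? ?]|[m [? ?]]]; subst e' b;
  last by case: (not_reversed fQ (or_introl erefl) e'Q).
1, 2: by split=> //; apply: nil_bleaves; move: e'Q; rewrite !mem_cat !mem_below /= orbF.
all: case: fL => fL L0; subst L'.
- have DQ : [:: eD] \in leaves (Forest BL R RL RL) by rewrite !mem_cat !mem_below !orbT.
  have fDa : f (pt (end_stream [:: eD] false)) = pt (end_stream [:: eL] false).
    by rewrite -(@point_aE [:: eD] false).
  have [e' [b [k' [e'Q ee' [kE] ab]]]] := image_at (x := v_a) fQ DQ fDa isT erefl.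
  subst k'; move: ab; rewrite andbF => /at_a_red[m em]; subst e'.
  move: e'Q; rewrite !mem_cat !mem_below /=.
  (* A longer comb in the range would send [b], the target of [eD], elsewhere. *)
  have fD := carries_red (erefl : colour_of [:: eD] = Some Red) ee'.
  case: ss fQ => [|s ss] fQ.
    rewrite inE => /eqP m0; rewrite m0 in fD.
    by apply: base_case Rn fQ _.
  rewrite -[rleaves _]/(below [:: r1] [:: [::]] ++ below [:: r2] (rleaves (comb ss)) ++ _).
  rewrite !mem_cat; case: m fD {ee'} => [|[|m]] fD; rewrite ?nil_below ?mem_below //= => _.
  have := carries_end true fD; rewrite -(@point_bE [:: eD] true) // fb.
  by move/(@pt_end_streamE [:: eR] [:: eD; r1] false true isT isT).
- have DQ : [:: eD; r1] \in leaves (Forest BL R RL (comb (nseq k.+1 BL))).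
    by rewrite !mem_cat !mem_below !orbT.
  have fDa : f (pt (end_stream [:: eD; r1] false)) = pt (end_stream [:: eL] false).
    by rewrite -(@point_aE [:: eD; r1] false).
  have [e' [b [k' [e'Q ee' [kE] ab]]]] := image_at (x := v_a) fQ DQ fDa isT erefl.
  subst k'; move: ab; rewrite andbF => /at_a_red[m em]; subst e'.
  move: e'Q; rewrite !mem_cat !mem_below /=.
  (* A trivial comb in the range would send another vertex to [b]. *)
  have fD := carries_red (erefl : colour_of [:: eD; r1] = Some Red) ee'.
  case: ss fQ => [|s ss] fQ.
    rewrite inE => /eqP m0; rewrite m0 in fD.
    have := carries_end true fD; rewrite -[RHS](@point_bE [:: eD] true) // -[RHS]fb.
    by move/(can_inj (homeo_funK f))/(@pt_end_streamE [:: eD; r1] [:: eR] true false isT isT).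
  rewrite -[rleaves _]/(below [:: r1] [:: [::]] ++ below [:: r2] (rleaves (comb ss)) ++ _).
  rewrite !mem_cat; case: m fD {ee'} => [|[|m]] fD; rewrite ?nil_below ?mem_below //= => _.
  have [[B1 B2 B3] [B4 B5 B6]] := Hbe.
  pose f1 := (be * f * be^-1)%g.
  suff Gf1 : G f1 by apply: GKl Gbe _; apply: (GKr (GV Gbe)); exact: Gf1.
  have f1Q : table f1 (Forest BL R (RN RL RL BL) (comb (nseq k BL)))
      (Forest s R' (RN RL RL BL) (comb ss)).
    apply: table_comp (table_inv (table_beta Hbe _ _ _ _ _ _)) _.
    by apply: table_comp fQ _; exact: table_beta.
  have conj e a : canonical_on be a e -> carries f a a false -> carries f1 e e false.
    move=> /carries_canonical ea aa.
    exact: carries_comp (carries_inv (homeo_funK be) ea) (carries_comp aa ea).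
  apply: IH (table_contract _ _ (contract_U _ _ _) (contract_U _ _ _) f1Q) _ => //.
    by case=> // _; [apply: conj B2 _|apply: conj B3 _|apply: conj B1 _].
  have [_ bb] := beta_fix_b; have [_ _ GbV] := G_fix_b_subgroup.
  by have [_ /= bV] := GbV _ beta_fix_b; rewrite /= bV fb.
Qed.

(** Domain and range are put in the form required by [comb_case]. *)
Lemma table_G (f : homeo airplane) Q Q' : table f Q Q' -> blue Q <= n -> G f.
Proof.
move=> fQ Qn; case: Q fQ Qn => L R U D fQ Qn.
have [R1 [k [[g1 Gg1 g1Q] E1]]] := @blue_to_R _ L R U D (leqnn _).
have f1Q := table_comp (table_inv g1Q) fQ.
have UQ : [:: eU] \in leaves (Forest BL R1 RL (comb (nseq k BL))).
  by rewrite !mem_cat !mem_below !orbT.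
have [s sQ [b /(carries_red (erefl : colour_of [:: eU] = Some Red)) fs]] := f1Q.1 _ UQ.
have sr : colour_of s = Some Red by rewrite -(carries_col fs).
have [g2 Gg2 [[[L2 R2 U2 D2] g2Q] g2s]] := reach_red (leqnn _) sQ sr.
have [L3 [ss [[g3 [Gg3 g3b] g3Q] _]]] := to_comb L2 R2 U2 D2.
have : G (g3 * (g2 * (f * g1^-1)))%g.
  apply: (@comb_case k _ R1 L3 R2 ss).
  - by move: Qn; rewrite E1 /blue /=; lia.
  - by apply: table_comp g3Q; apply: table_comp g2Q; exact: f1Q.
  rewrite /= (@point_bE [:: eU] false) //.
  have -> : f (g1^-1%g (pt (end_stream [:: eU] false))) = pt (end_stream s false).
    exact: (carries_end false fs).
  by rewrite g2s g3b -(@point_bE [:: eU] false).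
by move/(GKl Gg3)/(GKl Gg2)/(GKr (GV Gg1)).
Qed.
End Step.

Lemma T_A_sub : T_A `<=` G.
Proof.
move=> f /T_A_table[Q [Q' fQ]].
have [n] := ubnP (blue Q); elim: n f Q Q' fQ => // n IH f Q Q' fQ.
by rewrite ltnS; apply: table_G fQ => h P P' hP; exact: IH hP.
Qed.

End Generation.

(** * Subgroups, normalizers and rearrangement of products *)

Section Subgroups.
Local Open Scope group_scope.
Variable X : groupType.
Implicit Types (S H T : set X) (g h x y z : X).

Lemma sub_generated S : S `<=` generated S.
Proof. exact: sub_smallest. Qed.

Lemma generated_min S H : subgroup H -> S `<=` H -> generated S `<=` H.
Proof. by move=> HH SH; apply: smallest_sub. Qed.

Lemma generated_subgroup S : subgroup (generated S).
Proof.
split=> [|x y Sx Sy|x Sx] H [HH SH].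
- by case: HH.
- by case: (HH) => _ HM _; apply: HM; [exact: Sx|exact: Sy].
- by case: (HH) => _ _ HV; apply: HV; exact: Sx.
Qed.

Ltac gsimpl := rewrite ?(conjgE, invgM, invgK, mulgA);
  rewrite ?(mulgK, mulgVK, mulVg, mulgV, mul1g, mulg1, invg1).

Lemma conjg_fix g x : commute g x -> x ^ g = x.
Proof. by move=> gx; rewrite conjgE -gx mulKg. Qed.

Lemma conjg_fixV g x : commute g x -> x ^ g^-1 = x.
Proof. by move=> /commute_sym/commuteV/commute_sym; exact: conjg_fix. Qed.

Definition normalizes H g :=
  (forall h, H h -> H (h ^ g)) /\ (forall h, H h -> H (h ^ g^-1)).

Lemma normalizes_subgroup H : subgroup (normalizes H).
Proof.
split=> [|g h [g1 g2] [h1 h2]|g [g1 g2]].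
- by split=> h; rewrite ?invg1 conjg1.
- by split=> x Hx; rewrite ?invgM conjgM; auto.
- by split; rewrite ?invgK.
Qed.

Lemma normalizes_gen S g : (forall s, S s -> generated S (s ^ g)) ->
  (forall s, S s -> generated S (s ^ g^-1)) -> normalizes (generated S) g.
Proof.
have [H1 HM HV] := generated_subgroup S.
have conj_closed k : subgroup [set h | generated S (h ^ k)].
  by split=> [|x y|x] /=; rewrite ?conj1g ?conjMg ?conjVg; auto.
by move=> gS gVS; split; [exact: generated_min (conj_closed g) _
  |exact: generated_min (conj_closed g^-1) _].
Qed.

Lemma self_normalizes H : subgroup H -> H `<=` normalizes H.
Proof. by move=> [H1 HM HV] g Hg; split=> h Hh; rewrite conjgE ?invgK; auto. Qed.

Lemma commutators_in H S : subgroup H -> generated S `<=` normalizes H ->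
  (forall s t, S s -> S t -> H (commutator s t)) ->
  forall x y, generated S x -> generated S y -> H (commutator x y).
Proof.
move=> [H1 HM HV] SN SS.
have [G1 GM GV] := generated_subgroup S.
have step s : S s -> forall y, generated S y -> H (commutator s y).
  move=> Ss y Gy; suff: generated S y /\ H (commutator s y) by case.
  move: y Gy; apply: generated_min => [|t St]; last first.
    by split; [exact: sub_generated|exact: SS].
  split=> [|x y [Gx Hx] [Gy Hy]|x [Gx Hx]]; split; auto.
  - by rewrite /commutator; gsimpl.
  - have -> : commutator s (x * y) = commutator s x * commutator s y ^ x^-1.
      by rewrite /commutator; gsimpl.
    by apply: HM => //; apply: (SN _ Gx).2.
  - have -> : commutator s x^-1 = (commutator s x)^-1 ^ x.
      by rewrite /commutator; gsimpl.
    by apply: (SN _ Gx).1; auto.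
move=> x y Gx Gy; suff: generated S x /\ H (commutator x y) by case.
move: x Gx; apply: generated_min => [|t St]; last first.
  by split; [exact: sub_generated|exact: step].
split=> [|x z [Gx Hx] [Gz Hz]|x [Gx Hx]]; split; auto.
- by rewrite /commutator; gsimpl.
- have -> : commutator (x * z) y = commutator z y ^ x^-1 * commutator x y.
    by rewrite /commutator; gsimpl.
  by apply: HM => //; apply: (SN _ Gx).2.
- have -> : commutator x^-1 y = (commutator x y)^-1 ^ x.
    by rewrite /commutator; gsimpl.
  by apply: (SN _ Gx).1; auto.
Qed.

Section Normality.
Variables a b c d e : X.
Let y := d * e * d^-1.
Let f := commutator e^-1 (e^-1 * a).
Hypotheses (eb : commute e b) (ec : commute e c) (ye : commute y e).
Hypothesis yx : commute y (a * e * a^-1).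
Hypothesis dE : d = b * (d * b * d^-1) * b.
Let S := [set a; b; c; d; commutator d e; f].
Let H := generated S.

(** The element [commutator d e = y * e^-1] of [H] acts by conjugation like the
    inverse of [e] on the centralizer of [y].  This covers [f] and
    [d * b * d^-1], hence [d], and finally [a], because the conjugates of [f] by
    [e] and by [e * e] are [e^-1 * a * e * a^-1] and [a * e * a^-1 * e^-1]. *)
Lemma gens_commutators x z : generated [set a; b; c; d; e] x ->
  generated [set a; b; c; d; e] z -> H (commutator x z).
Proof.
have HH : subgroup H := generated_subgroup S.
have [H1 HM HV] := HH.
have [Ha Hb Hc Hd [Hde Hf]] :
    [/\ H a, H b, H c, H d & H (commutator d e) /\ H f].
  by split; last split; apply: sub_generated; rewrite /S /=; tauto.
have deE : commutator d e = y * e^-1 by [].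
have conj_e h : commute y h -> H h -> H (h ^ e^-1).
  move=> yh Hh; have -> : h ^ e^-1 = h ^ commutator d e.
    by rewrite deE conjgM (conjg_fix yh).
  exact: (self_normalizes HH Hde).1.
have conj_eV h : commute y h -> H h -> H (h ^ e).
  move=> yh Hh; have -> : h ^ e = h ^ (commutator d e)^-1.
    rewrite deE invgM invgK (commuteV (commute_sym ye)) conjgM (conjg_fixV yh) //.
  exact: (self_normalizes HH Hde).2.
pose b' := d * b * d^-1.
have yb' : commute y b'.
  by rewrite /commute /y /b'; gsimpl; rewrite -(mulgA d e b) eb; gsimpl.
have Hb' : H b' by apply: (HM); [exact: (HM)|exact: HV].
have yeV : commute y e^-1 := commuteV ye.
have fE : f = e^-1 * (e^-1 * (a * e * a^-1 * e)).
  by rewrite /f /commutator; gsimpl.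
have yf : commute y f.
  by rewrite fE; apply: (commuteM yeV); apply: (commuteM yeV); apply: commuteM.
have eN : normalizes H e.
  apply: normalizes_gen => s.
  - case=> [[[[[]|]|]|]|] ->.
    + have -> : a ^ e = f ^ e^-1 * a by rewrite fE; gsimpl.
      by apply: HM => //; exact: conj_e.
    + by rewrite conjg_fix.
    + by rewrite conjg_fix.
    + rewrite [in d ^ e]dE 2!conjMg (conjg_fix eb); apply: (HM) => //; apply: (HM) => //.
      exact: conj_eV.
    + rewrite conjg_fix // deE; apply: commuteM; first exact: commute_sym.
      exact: commuteV.
    + exact: conj_eV.
  - case=> [[[[[]|]|]|]|] ->.
    + have -> : a ^ e^-1 = ((f ^ e^-1) ^ e^-1)^-1 * a by rewrite fE; gsimpl.
      apply: HM => //; apply: HV; apply: (conj_e); last exact: conj_e.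
      by rewrite conjgE invgK; apply: commuteM => //; exact: commuteM.
    + by rewrite conjg_fixV.
    + by rewrite conjg_fixV.
    + rewrite [in d ^ _]dE 2!conjMg (conjg_fixV eb).
      apply: (HM) => //; apply: (HM) => //.
      exact: conj_e.
    + rewrite conjg_fixV // deE.
      by apply: commuteM; [exact: commute_sym|exact: commuteV].
    + exact: conj_e.
have SN s : H s \/ s = e -> normalizes H s.
  by case=> [Hs|->] //; exact: self_normalizes.
have gH s : [set a; b; c; d; e] s -> H s \/ s = e.
  by case=> [[[[]|]|]|] ->; [left|left|left|left|right].
apply: commutators_in => // [s Gs|s t /gH[Hs|->] /gH[Ht|->]].
- by apply: generated_min Gs => // [|t /gH/SN]; first exact: normalizes_subgroup.
- by rewrite /commutator; auto.
- have -> : commutator s e = s * s^-1 ^ e^-1 by rewrite /commutator; gsimpl.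
  by apply: HM => //; apply: eN.2; auto.
- have -> : commutator e t = t ^ e^-1 * t^-1 by rewrite /commutator; gsimpl.
  by apply: HM; [apply: eN.2|apply: HV].
- by rewrite /commutator; gsimpl.
Qed.
End Normality.

Section Abelianization.
Variable T : set X.
Hypothesis TT : subgroup T.
Let D := derived T.

Lemma derived_sub : D `<=` T.
Proof.
have [T1 TM TV] := TT.
by apply: generated_min => // _ [g Tg [h Th <-]]; rewrite /commutator; auto.
Qed.

Fixpoint product (s : seq X) : X := if s is x :: s' then x * product s' else 1.

Lemma product_cat s s' : product (s ++ s') = product s * product s'.
Proof. by elim: s => [|x s IH] /=; rewrite ?mul1g // IH mulgA. Qed.

Lemma derived_perm (I : eqType) (g : I -> X) (s s' : seq I) :
  (forall i, T (g i)) -> perm_eq s s' ->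
  D (product [seq g i | i <- s]) -> D (product [seq g i | i <- s']).
Proof.
move=> Tg ss'; have [T1 TM TV] := TT.
have [D1 DM DV] : subgroup D := generated_subgroup _.
have comD x y : T x -> T y -> D (commutator x y).
  by move=> Tx Ty; apply: sub_generated; exists x => //; exists y.
have normD x y : T x -> D y -> D (x * y * x^-1).
  move=> Tx Dy; have -> : x * y * x^-1 = commutator x y * y.
    by rewrite /commutator; gsimpl.
  by apply: DM => //; apply: comD => //; exact: derived_sub.
have Tp r : T (product [seq g i | i <- r]).
  by elim: r => //= i r IH; apply: TM.
suff E : D (product [seq g i | i <- s] * (product [seq g i | i <- s'])^-1).
  move=> Ds; have := DM _ _ (DV _ E) Ds.
  by rewrite invgM invgK mulgVK.
elim: s s' ss' => [|i s IH] s' ss'.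
  by move: ss'; rewrite perm_sym => /perm_nilP -> /=; rewrite mulgV.
have is' : i \in s' by rewrite -(perm_mem ss') mem_head.
case/splitPr: is' ss' => s1 s2 ss'.
have {}/IH H : perm_eq s (s1 ++ s2).
  by rewrite -(perm_cons i) (permPl ss') -cat1s perm_catCA.
move: H; rewrite !map_cat !product_cat /=.
set p := product _; set p1 := product _; set p2 := product _ => H.
have -> : g i * p * (p1 * (g i * p2))^-1 =
    (g i * (p * (p1 * p2)^-1) * (g i)^-1) * commutator (g i) p1.
  by rewrite /commutator; gsimpl.
by apply: DM; [exact: normD (Tg i) H|exact: comD (Tg i) (Tp s1)].
Qed.
End Abelianization.
End Subgroups.

(** * Relations verified by computation *)

(** A rearrangement given by finitely many replacements of prefixes; reversed
    pieces are split into their four canonical parts. *)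
Definition prefix_map := seq (word * word).

Definition realizes (f : airplane -> airplane) (l : prefix_map) :=
  forall p, p \in l -> carries f p.1 p.2 false.

Definition inverse_map (l : prefix_map) : prefix_map := [seq (p.2, p.1) | p <- l].

Definition act (l : prefix_map) (w : word) : option word :=
  ohead [seq p.2 ++ drop (size p.1) w | p <- l & prefix p.1 w].

Lemma realizes_inverse (f : homeo airplane) l :
  realizes f l -> realizes (f^-1)%g (inverse_map l).
Proof. by move=> Hf p /mapP[q /Hf qq ->]; exact: carries_inv (homeo_funK f) qq. Qed.

Lemma act_carries f l w w' : realizes f l -> colour_of w -> act l w = Some w' ->
  carries f w w' false.
Proof.
move=> Hf ow; rewrite /act.
case E: [seq _ | _ <- _] => [|v s] //= [<-].
have /mapP[p] : v \in [seq p.2 ++ drop (size p.1) w | p <- l & prefix p.1 w].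
  by rewrite E mem_head.
rewrite mem_filter => /andP[/prefixP[u wu] pl] ->.
by move: ow; rewrite wu drop_size_cat //; exact: carries_ext0 (Hf _ pl).
Qed.

Definition alpha_map : prefix_map :=
  [:: ([:: eL; bp], [:: eL]); ([:: eL; d_], [:: eU]); ([:: eL; u_], [:: eD]);
      ([:: eL; bm; bm], [:: eR; bm; bp]); ([:: eL; bm; bp], [:: eR; bm; bm]);
      ([:: eL; bm; u_], [:: eR; bm; d_]); ([:: eL; bm; d_], [:: eR; bm; u_]);
      ([:: eU], [:: eR; u_]); ([:: eD], [:: eR; d_]); ([:: eR], [:: eR; bp])].

Definition beta_map : prefix_map :=
  [:: ([:: eL], [:: eU; s_]); ([:: eU], [:: eU; r1]); ([:: eD; r1], [:: eU; r2]);
      ([:: eD; r2], [:: eD]); ([:: eD; s_], [:: eL]); ([:: eR], [:: eR])].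

Definition gamma_map : prefix_map :=
  [:: ([:: eL], [:: eL]); ([:: eD], [:: eD]); ([:: eR], [:: eR]);
      ([:: eU; r1], [:: eU; r1; r1]); ([:: eU; s_], [:: eU; r1; s_]);
      ([:: eU; r2; r1], [:: eU; r1; r2]); ([:: eU; r2; s_], [:: eU; s_]);
      ([:: eU; r2; r2], [:: eU; r2])].

Definition delta_map : prefix_map :=
  [:: ([:: eL], [:: eR]); ([:: eR], [:: eL]); ([:: eU], [:: eD]);
      ([:: eD], [:: eU])].

Definition epsilon_map : prefix_map :=
  [:: ([:: eL], [:: eL]); ([:: eU], [:: eU]); ([:: eD], [:: eD]);
      ([:: eR; bm; bp], [:: eR; bm]); ([:: eR; bm; d_], [:: eR; u_]);
      ([:: eR; bm; u_], [:: eR; d_]);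
      ([:: eR; bm; bm; bm], [:: eR; bp; bm; bp]);
      ([:: eR; bm; bm; bp], [:: eR; bp; bm; bm]);
      ([:: eR; bm; bm; u_], [:: eR; bp; bm; d_]);
      ([:: eR; bm; bm; d_], [:: eR; bp; bm; u_]);
      ([:: eR; u_], [:: eR; bp; u_]); ([:: eR; d_], [:: eR; bp; d_]);
      ([:: eR; bp], [:: eR; bp; bp])].

Lemma carries_reversed f e e' c : reversed_on f e e' -> colour_of (rcons e c) ->
  carries f (rcons e c) (rcons e' (flip c)) false.
Proof.
move=> /reversed_carries L; rewrite -!cats1 => oc.
by have := carries_ext L oc.
Qed.

(** The letters 0 to 4 stand for the five generators, 5 to 9 for their inverses. *)
Definition letter_map : nat -> prefix_map :=
  let ms := [:: alpha_map; beta_map; gamma_map; delta_map; epsilon_map] in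
  nth [::] (ms ++ map inverse_map ms).

(** The rightmost letter acts first.  The result is undefined when the word is
    too short to contain a prefix that is replaced. *)
Definition evaluate (s : seq nat) (w : word) : option word :=
  foldr (fun i o => obind (act (letter_map i)) o) (Some w) s.

Definition agree_at (n : nat) (s s' : seq nat) : bool :=
  all (fun w => if evaluate s w is Some v then evaluate s' w == Some v else false)
    [seq name E | E <- full_expansion n].

Section Relations.
Variables al be ga de ep : homeo airplane.
Hypotheses (Hal : is_alpha al) (Hbe : is_beta be) (Hga : is_gamma ga).
Hypotheses (Hde : is_delta de) (Hep : is_epsilon ep).
Local Open Scope group_scope.

Definition letter : nat -> homeo airplane :=
  nth 1 [:: al; be; ga; de; ep; al^-1; be^-1; ga^-1; de^-1; ep^-1].

Lemma letter_realizes i : realizes (letter i) (letter_map i).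
Proof.
have all_in f (l : prefix_map) :
    foldr (fun p P => carries f p.1 p.2 false /\ P) True l -> realizes f l.
  elim: l => // p l IH [Hp Hl] q; rewrite inE => /predU1P[->|] //; exact: IH.
have a : realizes al alpha_map.
  have [[A1 A2 A3 A4] [A5 A6 A7]] := Hal.
  by apply: all_in; do ?apply: conj => //=;
    first [exact/carries_canonical | exact: (carries_reversed A4)].
have b : realizes be beta_map.
  have [[A1 A2 A3] [A4 A5 A6]] := Hbe.
  by apply: all_in; do ?apply: conj => //=; exact/carries_canonical.
have c : realizes ga gamma_map.
  have [[A1 A2 A3] [A4 A5 A6 A7 A8]] := Hga.
  by apply: all_in; do ?apply: conj => //=; exact/carries_canonical.
have d : realizes de delta_map.
  have [A1 A2 A3 A4] := Hde.
  by apply: all_in; do ?apply: conj => //=; exact/carries_canonical.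
have e : realizes ep epsilon_map.
  have [[A1 A2 A3] [[A4 A5 A6 A7] [A8 A9 A10]]] := Hep.
  by apply: all_in; do ?apply: conj => //=;
    first [exact/carries_canonical | exact: (carries_reversed A7)].
case: i => [|[|[|[|[|[|[|[|[|[|i]]]]]]]]]];
  [exact: a|exact: b|exact: c|exact: d|exact: e|exact: realizes_inverse a
  |exact: realizes_inverse b|exact: realizes_inverse c|exact: realizes_inverse d
  |exact: realizes_inverse e|].
by rewrite /letter_map /= nth_nil.
Qed.

Definition value (s : seq nat) : homeo airplane := product [seq letter i | i <- s].

Lemma evaluate_carries s w v : colour_of w -> evaluate s w = Some v ->
  carries (value s) w v false.
Proof.
move=> ow; elim: s v => [|i s IH] v /=; first by case=> <-; exact: carries_id.
case sw: (evaluate s w) => [u|] //= iu; have L := IH _ sw.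
have ou : colour_of u by rewrite -(carries_col L).
exact: (carries_comp L (act_carries (@letter_realizes i) ou iu)).
Qed.

Lemma value_eq n s s' : agree_at n s s' -> value s = value s'.
Proof.
move=> /allP ss'; apply: (@homeo_ext _ _ [seq name E | E <- full_expansion n]).
  move=> w vw; have [E eE] := valid_edge n vw.
  exists (mkseq w n.+1); last first.
    by exists (fun i => w (n.+1 + i)); rewrite prepend_mkseq.
  apply/mapP; exists E; last by rewrite (edge_of_name eE).
  by apply: edge_full eE _; rewrite size_mkseq.
move=> e en; have := ss' _ en; case sv: (evaluate s e) => [v|] // /eqP s'v.
have oe : colour_of e.
  by case/mapP: en => E /full_expansionP[eE _] ->; rewrite colour_of_some eE.
by exists v, false; split; exact: evaluate_carries.
Qed.
Lemma T_A_subgroup : subgroup T_A.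
Proof.
split; [|exact: T_A_comp|exact: T_A_inv].
by apply: (@level_T_A 1 0) => e oe _; exists e; exact: carries_id.
Qed.

Lemma T_A_generated : T_A al -> T_A be -> T_A ga -> T_A de -> T_A ep ->
  derived T_A =
  generated [set al; be; ga; de; commutator de ep;
                 commutator ep^-1 (ep^-1 * al)].
Proof.
move=> Tal Tbe Tga Tde Tep; have TT := T_A_subgroup; have [T1 TM TV] := TT.
apply/seteqP; split.
  apply: generated_min; first exact: generated_subgroup.
  have GG := generated_subgroup [set al; be; ga; de; ep].
  have TG : T_A `<=` generated [set al; be; ga; de; ep].
    by apply: (T_A_sub Hal Hbe Hga Hde Hep GG); apply: sub_generated; rewrite /=; tauto.
  move=> _ [g /TG Gg [f /TG Gf <-]]; apply: gens_commutators Gg Gf.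
  - have := @value_eq 5 [:: 4; 1]%N [:: 1; 4]%N isT.
    by rewrite /value /= !mulg1.
  - have := @value_eq 5 [:: 4; 2]%N [:: 2; 4]%N isT.
    by rewrite /value /= !mulg1.
  - have := @value_eq 5 [:: 3; 4; 8; 4]%N [:: 4; 3; 4; 8]%N isT.
    by rewrite /value /= !mulg1 /commute !mulgA.
  - have := @value_eq 5 [:: 3; 4; 8; 0; 4; 5]%N [:: 0; 4; 5; 3; 4; 8]%N isT.
    by rewrite /value /= !mulg1 /commute !mulgA.
  - have := @value_eq 5 [:: 3]%N [:: 1; 3; 1; 8; 1]%N isT.
    by rewrite /value /= !mulg1 /commute !mulgA.
have [D1 DM DV] : subgroup (derived T_A) := generated_subgroup _.
have com x y : T_A x -> T_A y -> derived T_A (commutator x y).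
  by move=> Tx Ty; apply: sub_generated; exists x => //; exists y.
have Tl i : T_A (letter i).
  by case: i => [|[|[|[|[|[|[|[|[|[|i]]]]]]]]]]; rewrite /letter /= ?nth_nil; auto.
have perm s s' : agree_at 5 s [::] -> perm_eq s s' -> derived T_A (value s').
  move=> /value_eq s1 ss'; apply: (derived_perm TT Tl ss').
  by move: s1; rewrite /value /= => ->.
(* delta epsilon delta^-1 = alpha^-2 epsilon alpha: the class of alpha is 0. *)
have Dal : derived T_A al.
  have := perm [:: 0; 0; 3; 4; 8; 5; 9]%N [:: 0; 0; 5; 3; 8; 4; 9]%N isT isT.
  by rewrite /value /= !(mulg1, mulgV, mulVKg).
(* A conjugate of gamma supported in the interior of the circle cut at b is a
   product of commutators of beta and gamma. *)
have Dga : derived T_A ga.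
  have := perm [:: 3; 1; 2; 6; 8; 6; 7; 7; 1; 2; 6; 2; 1]%N
    [:: 2; 2; 7; 2; 7; 1; 6; 1; 6; 1; 6; 3; 8]%N isT isT.
  by rewrite /value /= !(mulg1, mulgV, mulVKg).
(* delta gamma delta^-1 = beta^-1 gamma^-1 beta^2: beta is twice gamma. *)
have Dbe : derived T_A be.
  have := perm [:: 3; 2; 8; 6; 6; 2; 1]%N [:: 3; 8; 2; 2; 1; 6; 6]%N isT isT.
  rewrite /value /= mulg1 mulVKg mulVKg => H.
  have := DM _ _ (DV _ Dga) (DM _ _ (DV _ Dga) H).
  by rewrite !mulKg => /DV; rewrite invgK.
(* delta = beta (delta beta delta^-1) beta: delta is three times beta. *)
have Dde : derived T_A de.
  have := perm [:: 1; 3; 1; 8; 1; 8]%N [:: 1; 1; 1; 3; 8; 8]%N isT isT.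
  rewrite /value /= mulg1 mulVKg => H.
  have := DM _ _ (DV _ Dbe) (DM _ _ (DV _ Dbe) (DM _ _ (DV _ Dbe) H)).
  by rewrite !mulKg => /DV; rewrite invgK.
apply: generated_min; first exact: generated_subgroup.
move=> _ [[[[[]|]|]|]|] -> //; apply: com; auto.
Qed.
End Relations.

Local Open Scope classical_set_scope.
Local Open Scope group_scope.

Theorem theorem6p12 (alpha beta gamma delta epsilon : homeo airplane) :
  T_A alpha -> T_A beta -> T_A gamma -> T_A delta -> T_A epsilon ->
  is_alpha alpha -> is_beta beta -> is_gamma gamma -> is_delta delta ->
  is_epsilon epsilon ->
  derived T_A =
  generated [set alpha; beta; gamma; delta; commutator delta epsilon;
                 commutator epsilon^-1 (epsilon^-1 * alpha)].
Proof.
by move=> Ta Tb Tc Td Te Ha Hb Hc Hd He; exact: T_A_generated.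
Qed.
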